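(* Suppose that $\alpha>1+\sqrt{1+d/2}$ and that $f$ satisfies: (A1) $f$ extends to $D^\varepsilon$ for some $\varepsilon>0$ and belongs to the isotropic Hölder class $\mathcal{H}_d(\alpha,L,D^\varepsilon)$ with $L>0$ and $\alpha>2$; (A2) there is a unique point $\mu$ in the interior of $D$ that maximizes $f$ on $D$, with $M=f(\mu)=\sup_{x\in D}f(x)$, and $\lambda_{\max}(Hf(\mu))<0$. If the convergence rate of the preliminary estimator is faster than $n^{-1/(2\alpha)}$, i.e. $\|\tilde\mu-\mu\|=o_p(n^{-1/(2\alpha)})$, and the localization parameter is $\delta_n=n^{-1/(2\alpha)}$, then the two-stage estimator $(\hat\mu,\hat M)$ satisfies, as $n\to\infty$, $$\|\hat{\mu}-\mu\| = O_p\bigl(n^{-(\alpha-1)/(2\alpha)}\bigr),\qquad \hat{M}-M = O_p\bigl(n^{-1/2}\bigr).$$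
   Context: Notation. $\|\cdot\|$ is the Euclidean norm on $\mathbb{R}^d$. For a multi-index $\mathbf{i}=(i_1,\dots,i_d)\in\mathbb{N}^d$ ($0\in\mathbb{N}$), $|\mathbf{i}|=\sum_k i_k$, $\mathbf{i}!=\prod_k i_k!$, $x^{\mathbf{i}}=\prod_k x_k^{i_k}$, $\mathbf{D}^{\mathbf{i}}f$ is the corresponding partial derivative. $Hf(x)$ is the Hessian matrix of $f$ at $x$; $\lambda_{\max}$ is the largest eigenvalue. $r_\alpha=\lceil\alpha-1\rceil$ is the largest integer strictly less than $\alpha$; $\mathbb{I}=\{\mathbf{i}\in\mathbb{N}^d: |\mathbf{i}|\le r_\alpha\}$. For $a\in\mathbb{R}^d$, $\delta>0$, $C(a,\delta)=\prod_{k=1}^d[a_k-\delta,a_k+\delta]$. All asymptotics are as $n\to\infty$, with $f$, $d$, $\alpha$ fixed; $O_p,o_p$ denote boundedness/convergence to zero in probability. Hölder class. $D\subset\mathbb{R}^d$ is compact and convex, $D^\varepsilon=\bigcup_{x\in D}B(x,\varepsilon)$ with $B(x,\varepsilon)$ the closed ball. $\mathcal{H}_d(\alpha,L,D^\varepsilon)$ is the set of $r_\alpha$-times differentiable $f:D^\varepsilon\to\mathbb{R}$ with $|f(x)-P_{f,x_0}(x)|\le L\|x-x_0\|^\alpha$ for all $x,x_0\in D^\varepsilon$, where $P_{f,x_0}(x)=\sum_{\mathbf{i}\in\mathbb{I}}\frac{1}{\mathbf{i}!}\mathbf{D}^{\mathbf{i}}f(x_0)(x-x_0)^{\mathbf{i}}$.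 Model. One can observe $Y=f(x)+\xi$ at chosen design points $x$; the errors $\xi$ of different observations are independent with mean zero and variance $\sigma^2$. Two-stage procedure, with total budget $n=n_1+n_2$. First stage: $0<n_1<n$ with $n_1/n\to\upsilon\in(0,1)$. One observes $f$ with error at $n_1$ design points $\tilde x_1,\dots,\tilde x_{n_1}$ spread approximately uniformly over $D$ (for some $c_1,c_2>0$ the balls $B(\tilde x_i,c_1n^{-1/d})$ cover $D$ and $\|\tilde x_i-\tilde x_j\|\ge c_2n^{-1/d}$ for $i\ne j$). The preliminary consistent estimator $\tilde\mu$ of $\mu$ is a $D$-valued measurable function of the first-stage data. Second stage: let $l$ be the smallest integer with $2l\ge r_\alpha$, and assume $n_2=n_3(2l+1)^d$ with $n_3\in\mathbb{N}$. The localization parameter is a deterministic sequence $\delta_n>0$, $\delta_n\to0$ ($n$ is large enough that $C(x,l\delta_n)\subset D^\varepsilon$ for every $x\in D$). The second-stage design points $x_1,\dots,x_{n_2}$ consist of each of the $(2l+1)^d$ points of $\prod_{k=1}^d\{\tilde\mu_k+j\delta_n: j=0,\pm1,\dots,\pm l\}$ repeated exactly $n_3$ times, and one observes $Y_k=f(x_k)+\xi_k$, $k=1,\dots,n_2$ (errors $\xi_k$ independent of the first-stage data). For $\vartheta=(\vartheta_{\mathbf{i}})_{\mathbf{i}\in\mathbb{I}}$ put $f_\vartheta(x)=\sum_{\mathbf{i}\in\mathbb{I}}\vartheta_{\mathbf{i}}x^{\mathbf{i}}$, and let $\tilde\vartheta$ be the (unique) minimizer of $\sum_{k=1}^{n_2}(Y_k-f_\vartheta(x_k))^2$.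 The two-stage estimator is $\hat\mu=\arg\max_{x\in C(\tilde\mu,l\delta_n)}f_{\tilde\vartheta}(x)$ (any measurable maximizer), $\hat M=f_{\tilde\vartheta}(\hat\mu)$. *)

(* Defs.v *)
From mathcomp Require Import all_boot all_order all_algebra.
From mathcomp Require Import all_classical all_reals all_analysis.

Set Implicit Arguments.
Unset Strict Implicit.
Unset Printing Implicit Defensive.

Import Order.TTheory GRing.Theory Num.Theory.
Import numFieldNormedType.Exports.

Local Open Scope classical_set_scope.
Local Open Scope ring_scope.

(* The library norm on 'rV[R]_d is the sup norm, hence the explicit Euclidean
   norm; both induce the same topology. *)
Definition enorm (R : realType) (d : nat) (x : 'rV[R]_d) : R :=
  Num.sqrt (\sum_(k < d) x 0 k ^+ 2).

Definition eball (R : realType) (d : nat) (x : 'rV[R]_d) (e : R) :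
  set 'rV[R]_d := [set y | enorm (y - x) <= e].

Definition thicken (R : realType) (d : nat) (D : set 'rV[R]_d) (e : R) :
  set 'rV[R]_d := \bigcup_(x in D) eball x e.

Definition cube (R : realType) (d : nat) (a : 'rV[R]_d) (e : R) :
  set 'rV[R]_d := [set x | forall k, a 0 k - e <= x 0 k <= a 0 k + e].

(* The order r_alpha: the largest integer strictly less than alpha. *)
Definition rord (R : realType) (alpha : R) : nat := `|Num.ceil (alpha - 1)|%N.

Lemma rordP (R : realType) (alpha : R) (n : nat) :
  0 < alpha -> (n%:R < alpha) = (n <= rord alpha)%N.
Proof.
move=> a0; have c0 : (0 <= Num.ceil (alpha - 1) :> int).
  by rewrite -ltzD1 -ltrBlDr ceil_gt_int rmorphB /= sub0r ltrBDr addNr.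
rewrite -lez_nat /rord gez0_abs // -ltzD1 -ltrBlDr ceil_gt_int rmorphB /=.
by rewrite ltrD2r.
Qed.

(* The half-width l of the second-stage grid: the least l with r_alpha <= 2l. *)
Definition gridl (R : realType) (alpha : R) : nat := uphalf (rord alpha).

Lemma gridlP (R : realType) (alpha : R) (l : nat) :
  (rord alpha <= 2 * l)%N = (gridl alpha <= l)%N.
Proof. by rewrite /gridl mul2n leq_uphalf_double. Qed.

(* Multi-indices of length d and total degree at most r. Bounding each entry
   by r loses nothing and makes the type finite. *)
Definition mindex (d r : nat) : Type :=
  {i : {ffun 'I_d -> 'I_r.+1} | (\sum_(k < d) i k <= r)%N}.

Definition mindex_fun (d r : nat) (i : mindex d r) (k : 'I_d) : nat :=
  \val i k.
Coercion mindex_fun : mindex >-> Funclass.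

Definition mfact (d : nat) (i : 'I_d -> nat) : nat := (\prod_(k < d) (i k)`!)%N.

Definition mpow (R : realType) (d : nat) (x : 'rV[R]_d) (i : 'I_d -> nat) : R :=
  \prod_(k < d) x 0 k ^+ i k.

(* Derivatives are taken relative to a set A, since functions of the Hoelder
   class live only on a closed set. They agree with the usual derivatives at
   interior points of A. If A is a convex set with nonempty interior, the
   relative gradient at a point of A is unique when it exists. *)
Definition is_grad (R : realType) (d : nat) (A : set 'rV[R]_d)
    (f : 'rV[R]_d -> R) (x v : 'rV[R]_d) : Prop :=
  (f y - f x - \sum_(k < d) v 0 k * (y - x) 0 k) / enorm (y - x)
    @[y --> within A x^'] --> (0 : R).

Definition grad (R : realType) (d : nat) (A : set 'rV[R]_d)
    (f : 'rV[R]_d -> R) (x : 'rV[R]_d) : 'rV[R]_d :=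
  xget 0 [set v | is_grad A f x v].

Definition partial (R : realType) (d : nat) (A : set 'rV[R]_d) (k : 'I_d)
    (f : 'rV[R]_d -> R) : 'rV[R]_d -> R := fun x => grad A f x 0 k.

Fixpoint ndifferentiable (R : realType) (d : nat) (A : set 'rV[R]_d) (r : nat)
    (f : 'rV[R]_d -> R) : Prop :=
  if r is r'.+1 then
    (forall x, A x -> exists v, is_grad A f x v) /\
    (forall k : 'I_d, ndifferentiable A r' (partial A k f))
  else True.

Definition mpartial (R : realType) (d : nat) (A : set 'rV[R]_d)
    (i : 'I_d -> nat) (f : 'rV[R]_d -> R) : 'rV[R]_d -> R :=
  foldr (fun k g => iter (i k) (partial A k) g) f (enum 'I_d).

Definition hessian (R : realType) (d : nat) (A : set 'rV[R]_d)
    (f : 'rV[R]_d -> R) (x : 'rV[R]_d) : 'M[R]_d :=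
  \matrix_(k, m) partial A k (partial A m f) x.

Definition lambda_max (R : realType) (d : nat) (H : 'M[R]_d) : R :=
  sup [set a : R | eigenvalue H a].

Definition taylor (R : realType) (d : nat) (A : set 'rV[R]_d) (r : nat)
    (f : 'rV[R]_d -> R) (x0 x : 'rV[R]_d) : R :=
  \sum_(i : mindex d r)
    ((mfact i)%:R^-1 * mpartial A i f x0 * mpow (x - x0) i).

(* Only the values of f on A matter. *)
Definition holder_class (R : realType) (d : nat) (alpha L : R)
    (A : set 'rV[R]_d) (f : 'rV[R]_d -> R) : Prop :=
  ndifferentiable A (rord alpha) f /\
  (forall x x0, A x -> A x0 ->
     `|f x - taylor A (rord alpha) f x0 x| <= L * enorm (x - x0) `^ alpha).

Definition poly_eval (R : realType) (d r : nat) (theta : mindex d r -> R)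
    (x : 'rV[R]_d) : R := \sum_(i : mindex d r) (theta i * mpow x i).

(* An index j : 'I_(2l+1) stands for the integer j - l in {-l, ..., l}. *)
Definition grid (d l : nat) : Type := {ffun 'I_d -> 'I_(2 * l + 1)}.

Definition grid_point (R : realType) (d l : nat) (a : 'rV[R]_d) (delta : R)
    (j : grid d l) : 'rV[R]_d :=
  \row_(k < d) (a 0 k + ((j k : nat)%:R - l%:R) * delta).

(* Second-stage observations are indexed by a grid point and a replicate. *)
Definition sse (R : realType) (d l r m : nat) (a : 'rV[R]_d) (delta : R)
    (Y : grid d l * 'I_m -> R) (theta : mindex d r -> R) : R :=
  \sum_(k : grid d l * 'I_m)
    (Y k - poly_eval theta (grid_point a delta k.1)) ^+ 2.

Definition is_argmin (R : realType) (T : Type) (g : T -> R) (t : T) : Prop :=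
  forall t', g t <= g t'.

Definition is_argmax_on (R : realType) (T : Type) (A : set T) (g : T -> R)
    (t : T) : Prop := A t /\ forall t', A t' -> g t' <= g t.

Section probability_notions.
Context {disp : measure_display} {Om : measurableType disp} {R : realType}.
Variable P : probability Om R.

(* Since some of the B i may be the whole line, this is equivalent to the
   product rule over all subfamilies. *)
Definition mutually_independent (I : finType) (X : I -> Om -> R) : Prop :=
  forall B : I -> set R, (forall i, measurable (B i)) ->
    P (\bigcap_(i in [set: I]) X i @^-1` B i)
      = (\prod_(i : I) P (X i @^-1` B i))%E.

Definition bigO_p (X : nat -> Om -> R) (a : nat -> R) : Prop :=
  forall eta : R, 0 < eta -> exists2 K : R, 0 < K &
    \forall n \near \oo, (P [set w | (K * a n < `|X n w|)%R] <= eta%:E)%E.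

Definition littleo_p (X : nat -> Om -> R) (a : nat -> R) : Prop :=
  forall e : R, 0 < e ->
    P [set w | (e * a n < `|X n w|)%R] @[n --> \oo] --> 0%E.

End probability_notions.

Definition sum_family (I J T : Type) (X : I -> T) (Y : J -> T) (k : I + J) : T :=
  match k with inl i => X i | inr j => Y j end.

(* Main.v *)
(** Expand [f] at its maximizer [mu] (not at the preliminary estimate): on the
    second-stage grid, centred at distance at most [delta] from [mu], [f] equals
    its Taylor polynomial [T] up to [O(delta `^ alpha)].  The least squares fit
    reproduces polynomials of degree [r_alpha] exactly, and in the rescaled
    variable [u = (x - a) / delta] its coefficients are fixed linear functions of
    the averages over replicates.  Hence the fitted polynomial is [T + q], where
    the coefficients of [q] in [u] are [O_p(delta `^ alpha)]: the averaged errors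
    are [O_p(n `^ (- 2^-1))] by Chebyshev's inequality, and this is exactly the
    order of [delta `^ alpha].

    Near [mu], [T x <= f mu - c |x - mu|^2]: the linear part of [T] vanishes at
    the maximum and its quadratic part is the Hessian form.  Comparing [T + q] at
    its maximizer and at [mu] bounds [c |muh - mu|^2] by the increment of [q],
    which is [O_p(delta `^ alpha) |muh - mu| / delta].  This gives the first rate;
    the second follows since [q] itself is [O_p(delta `^ alpha)]. *)

Require Import Defs.
From mathcomp Require Import all_boot all_order all_algebra.
From mathcomp Require Import all_classical all_reals all_analysis.
From mathcomp Require Import measurable_realfun.
From mathcomp Require Import ring lra.

Set Implicit Arguments.
Unset Strict Implicit.
Unset Printing Implicit Defensive.

Import Order.TTheory GRing.Theory Num.Theory.
Import numFieldNormedType.Exports.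

Local Open Scope classical_set_scope.
Local Open Scope ring_scope.

(** * Euclidean norm and polynomial functions *)

Section euclidean_norm.
Variables (R : realType) (d : nat).
Implicit Types x : 'rV[R]_d.

Lemma enorm_ge0 x : 0 <= enorm x.
Proof. exact: sqrtr_ge0. Qed.

Lemma sqr_enorm x : enorm x ^+ 2 = \sum_(k < d) x 0 k ^+ 2.
Proof. by rewrite sqr_sqrtr// sumr_ge0// => k _; exact: sqr_ge0. Qed.

Lemma enorm0 : enorm (0 : 'rV[R]_d) = 0.
Proof.
by rewrite /enorm big1 ?sqrtr0// => k _; rewrite mxE expr0n.
Qed.

Lemma coord_le_enorm x k : `|x 0 k| <= enorm x.
Proof.
rewrite -(ler_pXn2r (_ : 0 < 2)%N) ?nnegrE ?enorm_ge0// sqr_enorm.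
by rewrite real_normK ?num_real// (bigD1 k)//= lerDl sumr_ge0// => i _;
  exact: sqr_ge0.
Qed.

Lemma enorm_le_sum x : enorm x <= \sum_(k < d) `|x 0 k|.
Proof.
have s0 : 0 <= \sum_(k < d) `|x 0 k| by exact: sumr_ge0.
rewrite -(ler_pXn2r (_ : 0 < 2)%N) ?nnegrE ?enorm_ge0// sqr_enorm.
rewrite expr2 big_distrl/=; apply: ler_sum => k _.
rewrite -(real_normK (num_real _)) expr2 ler_wpM2l//.
by rewrite (bigD1 k)//= lerDl sumr_ge0.
Qed.

Lemma enorm_le_bound x b : (forall k, `|x 0 k| <= b) -> enorm x <= d%:R * b.
Proof.
move=> xb; apply: (le_trans (enorm_le_sum x)).
rewrite (le_trans (ler_sum _ (fun k _ => xb k)))//.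
by rewrite sumr_const card_ord mulr_natl.
Qed.

Lemma enormZ t x : enorm (t *: x) = `|t| * enorm x.
Proof.
rewrite /enorm -sqrtr_sqr -sqrtrM ?sqr_ge0// mulr_sumr.
by congr Num.sqrt; apply: eq_bigr => k _; rewrite mxE exprMn.
Qed.

Lemma enorm_eq0 x : enorm x = 0 -> x = 0.
Proof.
move=> x0; apply/rowP => k; rewrite mxE; apply/eqP; rewrite -normr_eq0.
by rewrite eq_le normr_ge0 -x0 coord_le_enorm.
Qed.

End euclidean_norm.

(** * Polynomials in several variables: closure properties and uniform bounds *)

Section polynomial_functions.
Variables (R : realType) (d : nat).
Implicit Types (h g : 'rV[R]_d -> R) (x u v : 'rV[R]_d).

(** Coefficients stay existential: a change of variables is needed only up to the existence of new
    coefficients, never as an explicit binomial formula. *)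
Definition ispoly r h := exists th : mindex d r -> R, h =1 poly_eval th.

Lemma mindex_exists r (i : 'I_d -> nat) : (\sum_(k < d) i k <= r)%N ->
  exists m : mindex d r, forall k, m k = i k.
Proof.
move=> ir.
have ltir k : (i k < r.+1)%N.
  by rewrite ltnS (leq_trans _ ir)// (bigD1 k)//= leq_addr.
pose m : {ffun 'I_d -> 'I_r.+1} := [ffun k => Ordinal (ltir k)].
have mr : (\sum_(k < d) m k <= r)%N.
  by rewrite (eq_bigr i)// => k _; rewrite ffunE.
by exists (exist _ m mr) => k; rewrite /mindex_fun/= ffunE.
Qed.

Lemma mindex_inj r (i j : mindex d r) : (forall k, i k = j k) -> i = j.
Proof. by move=> ij; apply/val_inj/ffunP => k; apply/val_inj/ij. Qed.

Lemma eq_mpow x (i j : 'I_d -> nat) : i =1 j -> mpow x i = mpow x j.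
Proof. by move=> ij; apply: eq_bigr => k _; rewrite ij. Qed.

Lemma ispoly_ext r h g : h =1 g -> ispoly r h -> ispoly r g.
Proof. by move=> hg [th hth]; exists th => x; rewrite -hg. Qed.

Lemma ispoly_mpow r (i : 'I_d -> nat) : (\sum_(k < d) i k <= r)%N ->
  ispoly r (fun x => mpow x i).
Proof.
move=> /mindex_exists[m mi]; exists (fun j => (j == m)%:R) => x.
rewrite /poly_eval (bigD1 m)//= eqxx mul1r big1 ?addr0.
  by apply: eq_mpow => k; rewrite mi.
by move=> j /negbTE ->; rewrite mul0r.
Qed.

Lemma ispoly0 r : ispoly r (fun=> 0).
Proof. by exists (fun=> 0) => x; rewrite /poly_eval big1// => i _; rewrite mul0r. Qed.

Lemma ispolyD r h g : ispoly r h -> ispoly r g -> ispoly r (h \+ g).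
Proof.
move=> [a ha] [b gb]; exists (a \+ b) => x; rewrite /= ha gb -big_split/=.
by apply: eq_bigr => i _; rewrite mulrDl.
Qed.

Lemma ispolyZ r c h : ispoly r h -> ispoly r (fun x => c * h x).
Proof.
move=> [a ha]; exists (fun i => c * a i) => x; rewrite ha mulr_sumr.
by apply: eq_bigr => i _; rewrite mulrA.
Qed.

Lemma ispoly_sum r (I : Type) (s : seq I) (F : I -> 'rV[R]_d -> R) :
  (forall i, ispoly r (F i)) -> ispoly r (fun x => \sum_(i <- s) F i x).
Proof.
move=> hF; elim: s => [|i s ihs].
  by apply: ispoly_ext (ispoly0 r) => x; rewrite big_nil.
by apply: ispoly_ext (ispolyD (hF i) ihs) => x; rewrite big_cons.
Qed.

Lemma mpowD x (i j : 'I_d -> nat) :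
  mpow x (fun k => (i k + j k)%N) = mpow x i * mpow x j.
Proof. by rewrite /mpow -big_split/=; apply: eq_bigr => k _; rewrite exprD. Qed.

Lemma ispolyM r s h g : ispoly r h -> ispoly s g -> ispoly (r + s) (h \* g).
Proof.
move=> [a ha] [b gb].
apply: (@ispoly_ext _ (fun x => \sum_(i : mindex d r) \sum_(j : mindex d s)
   (a i * (b j * mpow x (fun k => (mindex_fun i k + mindex_fun j k)%N))))) => [x|].
  rewrite /= ha gb /poly_eval mulr_suml; apply: eq_bigr => i _.
  rewrite mulr_sumr; apply: eq_bigr => j _.
  by rewrite mpowD; ring.
apply: ispoly_sum => i; apply: ispoly_sum => j.
apply/ispolyZ/ispolyZ/ispoly_mpow; rewrite big_split/=.
exact: leq_add (valP i) (valP j).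
Qed.

Lemma ispoly_cst r c : ispoly r (fun=> c).
Proof.
have : (\sum_(k < d) 0 <= r)%N by rewrite big1.
move=> /(@ispoly_mpow r (fun=> 0%N))/(ispolyZ c); apply: ispoly_ext => x.
rewrite /mpow big1 ?mulr1// => k _; exact: expr0.
Qed.

Lemma ispoly_coord k : ispoly 1 (fun x => x 0 k).
Proof.
have : (\sum_(m < d) (m == k) <= 1)%N.
  by rewrite (bigD1 k)//= eqxx big1// => m /negbTE ->.
move=> /ispoly_mpow; apply: ispoly_ext => x.
by rewrite /mpow (bigD1 k)//= eqxx big1 ?mulr1// => m /negbTE ->.
Qed.

Lemma ispoly_leq r s h : (r <= s)%N -> ispoly r h -> ispoly s h.
Proof.
move=> rs /ispolyM/(_ (ispoly_cst (s - r) 1)); rewrite subnKC//.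
by apply: ispoly_ext => x /=; rewrite mulr1.
Qed.

(** Listing the variables with multiplicity gives a sequence whose length is the degree, which
    permits induction one factor at a time. *)
Lemma mpow_seqE (i : 'I_d -> nat) : exists2 s : seq 'I_d,
  size s = (\sum_(k < d) i k)%N & forall x, mpow x i = \prod_(k <- s) x 0 k.
Proof.
exists (flatten [seq nseq (i k) k | k <- enum 'I_d]).
  rewrite size_flatten /shape -map_comp sumnE big_map big_enum/=.
  by apply: eq_bigr => k _; rewrite size_nseq.
move=> x; rewrite big_flatten/= big_map big_enum/=; apply: eq_bigr => k _.
by rewrite big_nseq -Monoid.iteropE.
Qed.

(** Each monomial becomes a product of as many affine factors as its degree, so the degree does not
    grow. This serves to pass between [x] and the rescaled variable [u = (x - a) / t], in both
    directions. *)
Lemma poly_eval_affine r (th : mindex d r -> R) (a : 'rV[R]_d) (t : R) :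
  ispoly r (fun u => poly_eval th (a + t *: u)).
Proof.
apply: ispoly_sum => i; apply: ispolyZ.
have [s sE mE] := mpow_seqE (mindex_fun i).
have ir : (size s <= r)%N by rewrite sE; exact: (valP i).
apply: (ispoly_leq ir); apply: (@ispoly_ext _ (fun u =>
  \prod_(k <- s) (a 0 k + t * u 0 k))) => [u|].
  by rewrite mE; apply: eq_bigr => k _; rewrite !mxE.
elim: s {sE mE ir} => [|k s ihs] /=.
  by apply: ispoly_ext (ispoly_cst 0 1) => u; rewrite big_nil.
have := ispolyM (ispolyD (ispoly_cst 1 (a 0 k)) (ispolyZ t (ispoly_coord k))) ihs.
by apply: ispoly_ext => u /=; rewrite big_cons.
Qed.

Lemma mpow_bound (i : 'I_d -> nat) x b : (forall k, `|x 0 k| <= b) ->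
  `|mpow x i| <= b ^+ (\sum_(k < d) i k).
Proof.
move=> xb; rewrite /mpow normr_prod expr_sum.
apply: ler_prod => k _; rewrite normr_ge0 normrX /=.
by case: (i k) => [|j]; rewrite ?expr0// lerXn2r ?nnegrE// (le_trans _ (xb k)).
Qed.

Lemma mpow_homog (i : 'I_d -> nat) t x :
  mpow (t *: x) i = t ^+ (\sum_(k < d) i k) * mpow x i.
Proof.
rewrite /mpow expr_sum -big_split/=; apply: eq_bigr => k _.
by rewrite mxE exprMn.
Qed.

(** Telescoping: exchanging one factor costs a coordinate difference times the remaining factors,
    each at most [b]. *)
Lemma mpow_lipschitz (i : 'I_d -> nat) b : 1 <= b ->
  exists2 C : R, 0 <= C & forall u v, (forall k, `|u 0 k| <= b) ->
    (forall k, `|v 0 k| <= b) -> `|mpow u i - mpow v i| <= C * enorm (u - v).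
Proof.
move=> b1; have b0 : 0 <= b by exact: le_trans b1.
have [s _ mE] := mpow_seqE i; exists ((size s)%:R * b ^+ size s) => [|u v ub vb].
  by rewrite mulr_ge0// exprn_ge0.
rewrite !mE; elim: s {mE} => [|k s ihs]; first by rewrite !big_nil subrr normr0 !mul0r.
rewrite !big_cons; set U := \prod_(k <- s) _; set V := \prod_(k <- s) _.
have Us : `|U| <= b ^+ size s.
  rewrite /U normr_prod -[leRHS]mul1r; elim: (s) => [|m z]; first by rewrite big_nil mulr1.
  by rewrite big_cons /= exprS !mul1r => ih; rewrite ler_pM// prodr_ge0.
rewrite (_ : _ - _ = (u - v) 0 k * U + v 0 k * (U - V)); last by rewrite !mxE; ring.
rewrite (le_trans (ler_normD _ _))// !normrM.
have := enorm_ge0 (u - v); have := coord_le_enorm (u - v) k.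
set e := enorm _ => ke e0.
have -> : (size (k :: s))%:R * b ^+ size (k :: s) * e =
    e * (b * b ^+ size s) + b * ((size s)%:R * b ^+ size s * e).
  by rewrite /= exprS -natr1; ring.
apply: lerD; last by apply: ler_pM.
by apply: ler_pM => //; rewrite (le_trans Us)// ler_peMl// exprn_ge0.
Qed.

(** The constant depends on [r] and [b] alone, so the bound holds uniformly over random
    coefficients. *)
Lemma poly_eval_lipschitz r b : 1 <= b ->
  exists2 C : R, 0 < C & forall (c : mindex d r -> R) e u v,
    (forall i, `|c i| <= e) -> (forall k, `|u 0 k| <= b) ->
    (forall k, `|v 0 k| <= b) ->
    `|poly_eval c u - poly_eval c v| <= C * e * enorm (u - v).
Proof.
move=> b1; have /choice[C HC] : forall i : mindex d r, exists C : R, 0 <= C /\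
    forall u v, (forall k, `|u 0 k| <= b) ->
    (forall k, `|v 0 k| <= b) -> `|mpow u i - mpow v i| <= C * enorm (u - v).
  by move=> i; have [C C0 H] := mpow_lipschitz i b1; exists C.
exists (1 + \sum_i C i) => [|c e u v ce ub vb].
  by rewrite ltr_pwDl// sumr_ge0// => i _; have [] := HC i.
apply: (@le_trans _ _ ((\sum_i C i) * e * enorm (u - v))).
  rewrite /poly_eval -sumrB (le_trans (ler_norm_sum _ _ _))// !mulr_suml.
  apply: ler_sum => i _; rewrite -mulrBr normrM (mulrC (C i)) -mulrA.
  by apply: ler_pM => //; apply: (HC i).2.
(* The sign of [e] is read off from the bound on some coefficient; the zero multi-index shows that
   there is one. *)
have [i _|no] := pickP [pred i : mindex d r | true]; last first.
  rewrite big1 ?addr0 ?mul0r; last by move=> i; have := no i.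
  have [i _] : exists m : mindex d r, forall k, m k = (fun=> 0%N) k.
    by apply: mindex_exists; rewrite big1.
  by have := no i.
have e0 : 0 <= e by rewrite (le_trans _ (ce i)).
by rewrite ler_wpM2r ?enorm_ge0// ler_wpM2r// lerDr.
Qed.

Lemma poly_eval_bound r b : 1 <= b ->
  exists2 C : R, 0 < C & forall (c : mindex d r -> R) e u,
    (forall i, `|c i| <= e) -> (forall k, `|u 0 k| <= b) ->
    `|poly_eval c u| <= C * e.
Proof.
move=> b1; have b0 : 0 <= b by exact: le_trans b1.
exists (\sum_(i : mindex d r) b ^+ r) => [|c e u ce ub].
  have [i _] : exists m : mindex d r, forall k, m k = (fun=> 0%N) k.
    by apply: mindex_exists; rewrite big1.
  rewrite (bigD1 i)//= ltr_pwDl ?exprn_gt0 ?(lt_le_trans _ b1)//.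
  by rewrite sumr_ge0// => *; rewrite exprn_ge0.
rewrite /poly_eval (le_trans (ler_norm_sum _ _ _))// mulr_suml.
apply: ler_sum => i _; rewrite normrM mulrC ler_pM//.
by rewrite (le_trans (mpow_bound (mindex_fun i) ub))// ler_weXn2l// (valP i).
Qed.

End polynomial_functions.

(** * Least squares on the grid *)

Section interpolation.
Variables (R : realType) (d : nat).

Definition grid_node l (j : grid d l) : 'rV[R]_d :=
  \row_(k < d) ((j k : nat)%:R - l%:R).

Lemma grid_pointE l (a : 'rV[R]_d) t (j : grid d l) :
  grid_point a t j = a + t *: grid_node j.
Proof. by apply/rowP => k; rewrite !mxE mulrC. Qed.

Lemma grid_node_bound l (j : grid d l) k : `|grid_node j 0 k| <= l%:R.
Proof.
have : (j k : nat)%:R <= (2 * l)%:R :> R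
  by rewrite ler_nat -ltnS -[X in (_ < X)%N]addn1 ltn_ord.
by rewrite mxE natrM ler_norml => h; apply/andP; split; have := ler0n R (j k); lra.
Qed.

(** [W b] holds the weights that read off the coefficient of degree [b] from the values at the
    nodes. *)
Lemma vandermonde_left_inverse m (x : 'I_m -> R) : injective x ->
  exists W : 'I_m -> 'I_m -> R,
    forall a b : 'I_m, \sum_(j < m) W b j * x j ^+ a = (a == b)%:R.
Proof.
move=> xinj; pose V := Vandermonde m (\row_j x j).
have Vu : V \in unitmx.
  rewrite unitmxE det_Vandermonde unitfE; apply/prodf_neq0 => i _.
  apply/prodf_neq0 => j ij; rewrite !mxE subr_eq0.
  by apply: contraTneq ij => /xinj ->; rewrite ltnn.
exists (fun b j => invmx V j b) => a b.
have /matrixP/(_ a b) := mulmxV Vu; rewrite !mxE => <-.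
by apply: eq_bigr => j _; rewrite !mxE mulrC.
Qed.

(* The inverse of a Vandermonde matrix is tensorized over the coordinates. *)
Lemma grid_unisolvent r l : (r <= 2 * l)%N ->
  exists W : mindex d r -> grid d l -> R, forall i i' : mindex d r,
    \sum_(j : grid d l) W i j * mpow (grid_node j) i' = (i' == i)%:R.
Proof.
move=> rl; pose x (j : 'I_(2 * l + 1)) : R := (j : nat)%:R - l%:R.
have [|W WE] := @vandermonde_left_inverse _ x.
  by move=> j j' /addIr/eqP; rewrite eqr_nat => /eqP/val_inj.
(* Every exponent is at most [r <= 2 * l], hence among the degrees that [2 * l + 1] nodes per
   coordinate can separate. *)
have ord_lt (i : mindex d r) k : (i k < 2 * l + 1)%N.
  by rewrite addn1 ltnS (leq_trans _ rl)// -ltnS; exact: ltn_ord.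
pose o i k := Ordinal (ord_lt i k).
exists (fun i j => \prod_(k < d) W (o i k) (j k)) => i i'.
transitivity (\prod_(k < d) \sum_(j < 2 * l + 1) W (o i k) j * x j ^+ o i' k).
  rewrite bigA_distr_bigA/=; apply: eq_bigr => j _.
  by rewrite big_split/=; congr (_ * _); apply: eq_bigr => k _; rewrite mxE.
under eq_bigr do rewrite WE.
have [->|ne] := eqVneq i' i; first by rewrite big1// => k _; rewrite eqxx.
have [k ik] : exists k, i' k != i k.
  apply/existsP; apply: contra_neqT ne => /existsPn h.
  by apply: mindex_inj => k; apply/eqP/negPn/h.
by rewrite (bigD1 k)//= -val_eqE/= (negbTE ik) mul0r.
Qed.

(** A left inverse [W] of the design matrix [F] forces full column rank. The Gram matrix is then
    invertible and the solution is unique and linear in [y]. *)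
Lemma normal_equations_solution (I J : finType) (F : J -> I -> R)
    (W : I -> J -> R) :
  (forall i i', \sum_j W i j * F j i' = (i' == i)%:R) ->
  exists B : I -> J -> R, forall (c : I -> R) (y : J -> R),
    (forall i', \sum_j (y j - \sum_i c i * F j i) * F j i' = 0) ->
    forall i, c i = \sum_j B i j * y j.
Proof.
move=> WF; pose A : 'M[R]_(#|I|, #|J|) := \matrix_(a, b) F (enum_val b) (enum_val a).
have sumJ (g : J -> R) : \sum_j g j = \sum_(b < #|J|) g (enum_val b).
  by rewrite big_enum_val.
have sumI (g : I -> R) : \sum_i g i = \sum_(b < #|I|) g (enum_val b).
  by rewrite big_enum_val.
(* If [v] annihilates the Gram matrix, then [v *m A] has zero square norm, and [W] recovers [v = 0]
   from it. *)
have Gu : A *m A^T \in unitmx.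
  rewrite -row_free_unit; apply: inj_row_free => v vA.
  have vA0 : v *m A = 0.
    have : (v *m A *m (v *m A)^T) 0 0 = 0.
      by rewrite trmx_mul mulmxA -(mulmxA v) vA mul0mx mxE.
    have vAT j : (v *m A)^T j 0 = (v *m A) 0 j by rewrite mxE.
    rewrite mxE => /psumr_eq0P h; apply/rowP => b; rewrite [RHS]mxE.
    apply/eqP; rewrite -sqrf_eq0 expr2 -[X in _ * X]vAT h// => j _.
    by rewrite vAT -expr2 sqr_ge0.
  apply/rowP => a; rewrite [RHS]mxE.
  have : \sum_(b < #|J|) W (enum_val a) (enum_val b) * (v *m A) 0 b = v 0 a.
    under eq_bigr do rewrite mxE mulr_sumr.
    have -> : v 0 a = v 0 a * \sum_j W (enum_val a) j * F j (enum_val a).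
      by rewrite WF eqxx mulr1.
    rewrite exchange_big/= (bigD1 a)//= [X in _ + X]big1 ?addr0 => [|a' na].
      by rewrite sumJ mulr_sumr; apply: eq_bigr => b _; rewrite mxE mulrCA.
    transitivity (v 0 a' * \sum_j W (enum_val a) j * F j (enum_val a')).
      by rewrite sumJ mulr_sumr; apply: eq_bigr => b _; rewrite mxE mulrCA.
    by rewrite WF (inj_eq enum_val_inj) (negbTE na) mulr0.
  by rewrite vA0 => <-; rewrite big1// => b _; rewrite mxE mulr0.
pose B := A^T *m invmx (A *m A^T).
exists (fun i j => B (enum_rank j) (enum_rank i)) => c y ne i.
pose cv : 'rV[R]_#|I| := \row_a c (enum_val a).
pose yv : 'rV[R]_#|J| := \row_b y (enum_val b).
have : cv *m (A *m A^T) = yv *m A^T.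
  apply/rowP => a; apply/eqP; rewrite eq_sym -subr_eq0 mulmxA.
  move: (ne (enum_val a)); rewrite sumJ => /eqP; rewrite 2!mxE -sumrB.
  congr (_ == 0); apply: eq_bigr => b _; rewrite !mxE -mulrBl.
  congr ((_ - _) * _); rewrite sumI; apply: eq_bigr => a' _.
  by rewrite !mxE.
move=> /(congr1 (mulmxr (invmx (A *m A^T)))); rewrite /= mulmxK// -mulmxA -/B.
move=> /matrixP/(_ 0 (enum_rank i)); rewrite !mxE enum_rankK => ->.
rewrite sumJ; apply: eq_bigr => b _; rewrite mxE mulrC enum_valK.
done.
Qed.

(** For [Q > 0] the quadratic takes the value [- S ^+ 2 / Q] at [z = S / Q]; for [Q = 0] it is
    linear in [z] and of constant sign. It yields both the normal equations and the eigenvector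
    equation of a maximizer. *)
Lemma linear_term_eq0 (Q S : R) : 0 <= Q ->
  (forall z, 0 <= z ^+ 2 * Q - 2 * z * S) -> S = 0.
Proof.
move=> Q0 key; have [Qz|Qn] := eqVneq Q 0.
  by have := key S; rewrite Qz mulr0 sub0r => h; nra.
have := key (S / Q).
have -> : (S / Q) ^+ 2 * Q - 2 * (S / Q) * S = - (S ^+ 2 / Q) by field.
rewrite oppr_ge0 => h; apply/eqP; rewrite -sqrf_eq0 eq_le sqr_ge0 andbT.
by move: h; rewrite pmulr_lle0// invr_gt0 lt_def Qn.
Qed.

(* Optimality is tested on the segments [th + t * th']; a quadratic in [t]
   minimal at [0] has no linear term. *)
Lemma sse_normal_equations l r m a t (y : grid d l * 'I_m -> R)
    (th th' : mindex d r -> R) :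
  is_argmin (sse a t y) th ->
  \sum_k (y k - poly_eval th (grid_point a t k.1)) *
     poly_eval th' (grid_point a t k.1) = 0.
Proof.
move=> hmin.
set e := fun k => y k - poly_eval th (grid_point a t k.1).
set g := fun k : grid d l * 'I_m => poly_eval th' (grid_point a t k.1).
set S := \sum_k _; pose Q := \sum_k g k ^+ 2.
have Q0 : 0 <= Q by apply: sumr_ge0 => k _; exact: sqr_ge0.
have key z : 0 <= z ^+ 2 * Q - 2 * z * S.
  have := hmin (fun i => th i + z * th' i).
  rewrite /sse -subr_ge0; congr (0 <= _).
  rewrite /Q /S !mulr_sumr -!sumrB; apply: eq_bigr => k _.
  rewrite (_ : poly_eval (fun i => _) _ = poly_eval th (grid_point a t k.1) + z * g k).
    rewrite /e /g; ring.
  rewrite /g /poly_eval mulr_sumr -big_split/=; apply: eq_bigr => i _.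
  by rewrite mulrDl mulrA.
exact: linear_term_eq0 key.
Qed.

(* [B] maps grid averages of the observations to the coefficients, in the
   variable [(x - a) / t], of any least squares fit; it does not depend on the
   centre [a], the mesh [t] or the number [m] of replicates. *)
Definition least_squares_matrix r l (B : mindex d r -> grid d l -> R) : Prop :=
  forall m a t (y : grid d l * 'I_m -> R) (th c : mindex d r -> R),
    (0 < m)%N -> t != 0 -> is_argmin (sse a t y) th ->
    (forall u, poly_eval th (a + t *: u) = poly_eval c u) ->
    forall i, c i = \sum_j B i j * (m%:R^-1 * \sum_(s < m) y (j, s)).

(** In the variable [u], and after averaging over replicates, the normal equations live on the fixed
    integer grid, where [a], [t] and [m] no longer appear. *)
Lemma least_squares_matrix_exists r l : (r <= 2 * l)%N ->
  exists B : mindex d r -> grid d l -> R, least_squares_matrix B.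
Proof.
move=> rl; have [W WE] := grid_unisolvent rl.
have [B BE] := normal_equations_solution WE; exists B => m a t y th c m0 t0 hmin hc.
apply: BE => i'.
(* [th'] is the polynomial in [x] whose expression in [u] is the monomial of index [i']. *)
have [th' th'E] := poly_eval_affine (fun i => (i == i')%:R : R) (- (t^-1 *: a)) t^-1.
have := sse_normal_equations th' hmin.
rewrite (_ : \sum_k _ = \sum_j \sum_s (y (j, s) - poly_eval th (grid_point a t j)) *
    poly_eval th' (grid_point a t j)); last first.
  by rewrite pair_bigA/=; apply: eq_bigr => -[].
have m0R : m%:R != 0 :> R by rewrite pnatr_eq0 -lt0n.
move=> /(congr1 ( *%R m%:R^-1)); rewrite mulr0; apply: etrans; rewrite mulr_sumr.
apply: eq_bigr => j _; rewrite -mulr_suml sumrB sumr_const card_ord.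
rewrite grid_pointE hc -th'E.
rewrite scalerDr scalerA mulVf// scale1r addKr.
rewrite mulrA mulrBr -(mulr_natl (poly_eval c _)) (mulrA _ m%:R) mulVf// mul1r.
congr ((_ - _) * _).
rewrite /poly_eval (bigD1 i')//= eqxx mul1r big1 ?addr0// => i /negbTE ->.
by rewrite mul0r.
Qed.

End interpolation.

(** * The Taylor polynomial at the maximizer *)

Section second_differences.
Variables (R : realType) (d : nat).
Implicit Types (A : set 'rV[R]_d) (f : 'rV[R]_d -> R) (x y u v : 'rV[R]_d).

Lemma nbhs_enorm A x : nbhs x A ->
  exists2 r : R, 0 < r & forall y, enorm (y - x) < r -> A y.
Proof.
move=> /nbhs_ballP[r /= r0 rA]; exists r => // y yr; apply: rA.
split=> [|i k] //; rewrite (ord1 i) /ball/= distrC (le_lt_trans _ yr)//.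
by have := coord_le_enorm (y - x) k; rewrite !mxE.
Qed.

Lemma is_grad_bound A f x v e : is_grad A f x v -> 0 < e ->
  exists2 r : R, 0 < r & forall y, A y -> enorm (y - x) < r ->
    `|f y - f x - \sum_(k < d) v 0 k * (y - x) 0 k| <= e * enorm (y - x).
Proof.
move=> /cvgrPdist_le/(_ e) + e0 => /(_ e0).
rewrite near_withinE => h.
have /nbhs_enorm[r r0 rP] : nbhs x [set y | y != x -> A y ->
    `|0 - (f y - f x - \sum_(k < d) v 0 k * (y - x) 0 k) / enorm (y - x)| <= e].
  exact: h.
exists r => // y Ay yr; have [->|ne] := eqVneq y x.
  rewrite !subrr enorm0 mulr0 big1 ?subrr ?normr0// => k _.
  by rewrite mxE mulr0.
have n0 : 0 < enorm (y - x).
  rewrite lt_def enorm_ge0 andbT; apply: contra_neq ne => /enorm_eq0/eqP.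
  by rewrite subr_eq0 => /eqP.
have := rP y yr ne Ay; rewrite sub0r normrN normrM normfV (gtr0_norm n0).
by rewrite ler_pdivrMr.
Qed.

Lemma grad_is_grad A f x : (exists v, is_grad A f x v) -> is_grad A f x (grad A f x).
Proof. exact: xgetPex. Qed.

Lemma is_derive_line A f x v u (t : R) : nbhs (x + t *: u) A ->
  is_grad A f (x + t *: u) v ->
  is_derive t 1 (fun s => f (x + s *: u)) (\sum_(k < d) u 0 k * v 0 k).
Proof.
move=> nA gv; set w := x + t *: u.
suff H : h^-1 *: (((fun s => f (x + s *: u)) \o shift t) (h *: 1) - f w)
    @[h --> (0:R)^'] --> \sum_(k < d) u 0 k * v 0 k.
  by apply: DeriveDef; [apply/cvg_ex; eexists; exact: H | apply: cvg_lim => //].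
apply/cvgrPdist_le => e e0.
(* The summand 1 covers the direction [u = 0]. *)
have N0 : 0 < 1 + enorm u by have := enorm_ge0 u; lra.
have [r1 r10 r1A] := nbhs_enorm nA.
have [r2 r20 r2P] := is_grad_bound gv (divr_gt0 e0 N0).
near=> h.
have h0 : h != 0 by near: h; exact: nbhs_dnbhs_neq.
have hr : `|h| * (1 + enorm u) < Num.min r1 r2.
  rewrite -ltr_pdivlMr//; near: h; apply: dnbhs0_lt.
  by rewrite divr_gt0// lt_min r10.
have hu : enorm (w + h *: u - w) = `|h| * enorm u by rewrite addrC addKr enormZ.
have hu' : enorm (w + h *: u - w) < Num.min r1 r2.
  by rewrite hu (le_lt_trans _ hr)// ler_wpM2l// lerDr.
move: (hu'); rewrite lt_min => /andP[hr1 hr2].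
have := r2P _ (r1A _ hr1) hr2.
rewrite hu /= [X in _ <= X](_ : _ = `|h| * (e * (enorm u / (1 + enorm u)))); last first.
  by ring.
have -> : x + (h *: (1 : R) + t) *: u = w + h *: u.
  by rewrite scalerDl addrCA addrC -/w /GRing.scale/= mulr1.
rewrite -/w => H.
rewrite distrC.
have -> : h^-1 *: (f (w + h *: u) - f w) - \sum_k u 0 k * v 0 k =
   h^-1 * (f (w + h *: u) - f w - \sum_k v 0 k * (w + h *: u - w) 0 k).
  rewrite [RHS]mulrBr; congr (_ - _); rewrite mulr_sumr; apply: eq_bigr => k _.
  by rewrite addrC addKr mxE; field.
rewrite normrM normfV ler_pdivrMl ?normr_gt0//.
rewrite (le_trans H)// ler_wpM2l// ger_pMr// ler_pdivrMr// mul1r lerDr//.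
Unshelve. all: by end_near. Qed.

Definition second_diff f x u v : R :=
  f (x + u + v) - f (x + u) - f (x + v) + f x.

Lemma second_diffC f x u v : second_diff f x u v = second_diff f x v u.
Proof. by rewrite /second_diff (addrAC x u v); ring. Qed.

(** The index order matters until symmetry is known: [f] is differentiated first along [u], then
    along [v]. *)
Definition hform A f x u v : R :=
  \sum_k \sum_m u 0 k * v 0 m * hessian A f x m k.

Lemma enorm_line_le (x : 'rV[R]_d) (s h : R) u v : 0 <= s <= h ->
  enorm (x + s *: u + h *: v - x) <= h * d%:R * (enorm u + enorm v).
Proof.
move=> /andP[s0 sh]; rewrite -(addrA x) (addrC x) addrK mulrAC mulrC.
apply: enorm_le_bound => k; rewrite !mxE (le_trans (ler_normD _ _))// mulrDr !normrM.
have h0 := le_trans s0 sh; rewrite (ger0_norm s0) (ger0_norm h0).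
apply: lerD; first by apply: ler_pM => //; exact: coord_le_enorm.
by apply: ler_wpM2l => //; exact: coord_le_enorm.
Qed.

(** The second difference is the increment of a function of one variable, to which the mean value
    theorem applies; the first partial derivatives are then expanded at [x] only. No continuity of
    second derivatives is involved. *)
Lemma second_diff_hform A f x u v e : A° x ->
  ndifferentiable A 2 f -> 0 < e ->
  exists2 h0 : R, 0 < h0 & forall h, 0 < h < h0 ->
    `|second_diff f x (h *: u) (h *: v) - h ^+ 2 * hform A f x u v| <= e * h ^+ 2.
Proof.
move=> Ax [fA fkA] e0.
have fkA' k : exists w, is_grad A (partial A k f) x w.
  by have [H _] := fkA k; apply: H; exact: interior_subset.
pose N := d%:R * (enorm u + enorm v); have N0 : 0 <= N.
  by rewrite mulr_ge0// addr_ge0// enorm_ge0.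
pose S := \sum_k `|u 0 k|; have S0 : 0 <= S by apply: sumr_ge0.
(* Two remainders of size [e' * (h * N)] per coordinate, weighted by [|u_k|], add up to at most
   [e * h]. *)
pose e' := e / (1 + S * (N + N)).
have den0 : 0 < 1 + S * (N + N) by have := mulr_ge0 S0 (addr_ge0 N0 N0); lra.
have e'0 : 0 < e' by exact: divr_gt0.
have [r0 r00 inA] := nbhs_enorm (nbhs_interior Ax).
have /choice[r rP] : forall k, exists r : R, 0 < r /\
    forall y, A y -> enorm (y - x) < r ->
    `|partial A k f y - partial A k f x -
       \sum_m grad A (partial A k f) x 0 m * (y - x) 0 m| <= e' * enorm (y - x).
  by move=> k; have [r ? ?] := is_grad_bound (grad_is_grad (fkA' k)) e'0; exists r.
pose rm := \big[Num.min/r0]_k r k.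
have rm0 : 0 < rm by apply: lt_bigmin => // k _; have [] := rP k.
have rmr0 : rm <= r0 by exact: bigmin_le_id.
have rmr k : rm <= r k by exact: bigmin_le.
exists (rm / (1 + N)) => [|h /andP[h0 hh]]; first by rewrite divr_gt0//; lra.
have hN : h * N < rm.
  move: hh; rewrite ltr_pdivlMr; last by lra.
  by apply: le_lt_trans; rewrite ler_wpM2l ?(ltW h0)//; lra.
have near1 s : 0 <= s <= h ->
    enorm (x + s *: u + h *: v - x) < rm /\ enorm (x + s *: u - x) < rm.
  move=> sh; split; apply: le_lt_trans hN; rewrite mulrA.
    exact: enorm_line_le.
  have := enorm_line_le x u 0 sh; rewrite scaler0 addr0 enorm0 addr0 => /le_trans; apply.
  rewrite ler_wpM2l ?mulr_ge0 ?(ltW h0)// lerDl; exact: enorm_ge0.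
have near_int y : enorm (y - x) < rm -> A° y.
  by move=> yr; apply: inA; exact: lt_le_trans yr rmr0.
pose G y := grad A f y.
have gradG y : enorm (y - x) < rm -> is_grad A f y (G y).
  by move=> /near_int Ay; apply/grad_is_grad/fA; exact: interior_subset.
pose phi (t : R) := f (x + h *: v + t *: u) - f (x + t *: u).
pose dphi (t : R) := \sum_k u 0 k * G (x + h *: v + t *: u) 0 k -
  \sum_k u 0 k * G (x + t *: u) 0 k.
have swap t : x + h *: v + t *: u = x + t *: u + h *: v by rewrite addrAC.
have dphiP t : 0 <= t <= h -> is_derive t 1 phi (dphi t).
  move=> /near1[n1 n2]; rewrite -swap in n1.
  apply: is_deriveB.
    by apply: (@is_derive_line A); [exact: near_int|exact: gradG].
  by apply: (@is_derive_line A); [exact: near_int|exact: gradG].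
have [||c] := @MVT _ phi dphi 0 h h0.
- by move=> t; rewrite in_itv/= => /andP[t0 th]; apply: dphiP; rewrite !ltW.
- apply: derivable_within_continuous => t; rewrite in_itv/= => th.
  by have [] := dphiP t th.
rewrite in_itv/= subr0 => /andP[c0 ch] E.
have ch' : 0 <= c <= h by rewrite !ltW.
have -> : second_diff f x (h *: u) (h *: v) = dphi c * h.
  by rewrite -E /phi /second_diff !scale0r !addr0 swap; ring.
have [n1 n2] := near1 c ch'.
(* The linear terms at the displacements [c *: u + h *: v] and [c *: u] differ by the Hessian
   applied to [h *: v], so only the two remainders are left. *)
have -> : dphi c * h - h ^+ 2 * hform A f x u v =
  h * \sum_k u 0 k * (
   (partial A k f (x + c *: u + h *: v) - partial A k f x -
       \sum_m grad A (partial A k f) x 0 m * (x + c *: u + h *: v - x) 0 m) -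
   (partial A k f (x + c *: u) - partial A k f x -
       \sum_m grad A (partial A k f) x 0 m * (x + c *: u - x) 0 m)).
  rewrite /dphi swap -sumrB mulrC expr2 -mulrA -mulrBr; congr (_ * _).
  rewrite /hform mulr_sumr -sumrB; apply: eq_bigr => k _.
  rewrite -mulrBr -/(G _ 0 k) (_ : \sum_m _ = u 0 k * \sum_m v 0 m * hessian A f x m k); last first.
    by rewrite mulr_sumr; apply: eq_bigr => m _; rewrite mulrA.
  rewrite mulrCA -mulrBr; congr (_ * _).
  have -> (p q z s t : R) : p - q - s - (z - q - t) = p - z - (s - t) by ring.
  congr (_ - _); rewrite -sumrB mulr_sumr; apply: eq_bigr => m _.
  by rewrite -mulrBr !mxE /partial; ring.
rewrite normrM (gtr0_norm h0) expr2 mulrCA ler_pM2l//.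
rewrite (le_trans (ler_norm_sum _ _ _))//.
apply: (@le_trans _ _ (\sum_k `|u 0 k| * (e' * (h * N) + e' * (h * N)))).
  apply: ler_sum => k _; rewrite normrM ler_wpM2l//.
  have [_ rk] := rP k; have Ay y : enorm (y - x) < rm -> A y.
    by move=> /near_int; exact: interior_subset.
  rewrite (le_trans (ler_normB _ _))//; apply: lerD.
    rewrite (le_trans (rk _ (Ay _ n1) (lt_le_trans n1 (rmr k))))// ler_wpM2l ?(ltW e'0)//.
    by rewrite /N mulrA; exact: enorm_line_le.
  rewrite (le_trans (rk _ (Ay _ n2) (lt_le_trans n2 (rmr k))))// ler_wpM2l ?(ltW e'0)//.
  have := enorm_line_le x u 0 ch'; rewrite scaler0 addr0 enorm0 addr0 => /le_trans; apply.
  rewrite /N mulrA ler_wpM2l ?mulr_ge0 ?(ltW h0)// lerDl; exact: enorm_ge0.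
rewrite -mulr_suml -/S.
rewrite (_ : S * _ = e * h * (S * (N + N) / (1 + S * (N + N)))); last first.
  by rewrite /e'; ring.
by rewrite ger_pMr ?mulr_gt0// ler_pdivrMr// mul1r lerDr.
Qed.

End second_differences.

(** * Symmetry of the Hessian, its link with second-order expansions, and its largest eigenvalue *)

Section hessian_at_maximum.
Variables (R : realType) (d : nat).
Implicit Types (A D : set 'rV[R]_d) (f : 'rV[R]_d -> R) (x y u v : 'rV[R]_d).

(** Schwarz's theorem: the second difference is symmetric in [u] and [v], and both forms are its
    limit after division by [h ^+ 2]. *)
Lemma hform_sym A f x u v : A° x -> ndifferentiable A 2 f ->
  hform A f x u v = hform A f x v u.
Proof.
move=> Ax fA; apply/eqP; rewrite -subr_eq0 -normr_le0; apply/ler_addgt0Pr => e e0.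
rewrite add0r.
have [h1 h10 H1] := second_diff_hform u v Ax fA (divr_gt0 e0 (ltr0n _ 2)).
have [h2 h20 H2] := second_diff_hform v u Ax fA (divr_gt0 e0 (ltr0n _ 2)).
pose h := Num.min h1 h2 / 2.
have m0 : 0 < Num.min h1 h2 by rewrite lt_min h10.
have h0 : 0 < h by rewrite divr_gt0.
have : h < Num.min h1 h2 by rewrite /h; lra.
rewrite lt_min => /andP[hh1 hh2].
have := H1 h; rewrite h0 hh1 => /(_ isT); have := H2 h; rewrite h0 hh2 => /(_ isT).
rewrite second_diffC.
set S := second_diff _ _ _ _; set a := hform _ _ _ u v; set b := hform _ _ _ v u.
have hh : 0 < h ^+ 2 by exact: exprn_gt0.
rewrite !ler_norml => /andP[b1 b2] /andP[c1 c2].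
rewrite -(ler_pM2l hh) -(ler_pM2l hh (a - b)).
by apply/andP; split; nra.
Qed.

(** With equal increments [h *: v] the expansion makes the second difference about
    [(4 - 2) * h ^+ 2 * Q v]. This identifies the quadratic Taylor part with the Hessian form
    without evaluating any iterated partial derivative. *)
Lemma hform_quadratic A f x (Q : 'rV[R]_d -> R) v : A° x -> ndifferentiable A 2 f ->
  (forall t y, Q (t *: y) = t ^+ 2 * Q y) ->
  (forall e, 0 < e -> exists2 r, 0 < r & forall y, enorm y < r ->
     `|f (x + y) - (f x + Q y)| <= e * enorm y ^+ 2) ->
  hform A f x v v = 2 * Q v.
Proof.
move=> Ax fA Qh fQ; apply/eqP; rewrite -subr_eq0 -normr_le0; apply/ler_addgt0Pr => e e0.
rewrite add0r.
(* The expansion errors are [e / 3] at [2 * h] and twice [e / 12] at [h]; with [e / 2] from the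
   second difference they total [e]. *)
have K0 : 0 < 12 * (1 + enorm v ^+ 2) by have := sqr_ge0 (enorm v); lra.
have [h1 h10 H1] := second_diff_hform v v Ax fA (divr_gt0 e0 (ltr0n _ 2)).
have [r r0 rP] := fQ _ (divr_gt0 e0 K0).
have N0 : 0 < 2 * (1 + enorm v) by have := enorm_ge0 v; lra.
pose h := Num.min h1 (r / (2 * (1 + enorm v))) / 2.
have m0 : 0 < Num.min h1 (r / (2 * (1 + enorm v))) by rewrite lt_min h10 divr_gt0.
have h0 : 0 < h by rewrite divr_gt0.
have : h < Num.min h1 (r / (2 * (1 + enorm v))) by rewrite /h; lra.
rewrite lt_min => /andP[hh1]; rewrite ltr_pdivlMr// => hh2.
have := H1 h; rewrite h0 hh1 => /(_ isT) e1.
have n1 : enorm (h *: v) < r.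
  rewrite enormZ gtr0_norm//; have := enorm_ge0 v; nra.
have n2 : enorm ((2 * h) *: v) < r.
  rewrite enormZ gtr0_norm ?mulr_gt0//; have := enorm_ge0 v; nra.
have := rP _ n1; have := rP _ n2.
have hh0 : 0 < 2 * h by rewrite mulr_gt0.
rewrite !Qh !enormZ (gtr0_norm h0) (gtr0_norm hh0).
move: e1; rewrite /second_diff.
have -> : x + h *: v + h *: v = x + (2 * h) *: v.
  by rewrite -addrA -scalerDl -mulr2n mulr_natl.
set F2 := f (x + (2 * h) *: v); set F1 := f (x + h *: v); set B := hform _ _ _ _ _.
set q := Q v; set n := enorm v; set k := e / (12 * _) => e1 e2 e3.
have kn : k * n ^+ 2 <= e / 12.
  rewrite /k -mulrA ler_wpM2l ?(ltW e0)//= ler_pdivrMl//.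
  by rewrite -/n; lra.
have h2 : 0 < h ^+ 2 by exact: exprn_gt0.
have e2' : `|F2 - (f x + (2 * h) ^+ 2 * q)| <= e / 3 * h ^+ 2.
  by apply: (le_trans e2); have := ler_wpM2r (ltW h2) kn; lra.
have e3' : `|F1 - (f x + h ^+ 2 * q)| <= e / 12 * h ^+ 2.
  by apply: (le_trans e3); have := ler_wpM2r (ltW h2) kn; lra.
move: e1 e2' e3'; rewrite !ler_norml => /andP[a1 a2] /andP[b1 b2] /andP[c1 c2].
rewrite -(ler_pM2l h2) -(ler_pM2l h2 (B - 2 * q)).
by apply/andP; split; nra.
Qed.

(** Rayleigh's principle: the form attains its maximum [la] on the compact unit sphere, and the
    maximizer is an eigenvector for [la]. *)
Lemma lambda_max_bound (H : 'M[R]_d) : (0 < d)%N -> (forall k m, H k m = H m k) ->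
  forall v, \sum_k \sum_m v 0 k * v 0 m * H m k <= lambda_max H * enorm v ^+ 2.
Proof.
move=> d0 Hsym.
pose b u v := \sum_k \sum_m u 0 k * v 0 m * H m k.
have bC u v : b u v = b v u.
  rewrite /b exchange_big/=; apply: eq_bigr => k _; apply: eq_bigr => m _.
  by rewrite Hsym (mulrC (v 0 _)).
have bD u v w : b u (v + w) = b u v + b u w.
  rewrite /b -big_split/=; apply: eq_bigr => k _; rewrite -big_split/=.
  by apply: eq_bigr => m _; rewrite mxE; ring.
have bZ t u v : b u (t *: v) = t * b u v.
  rewrite /b mulr_sumr; apply: eq_bigr => k _; rewrite mulr_sumr.
  by apply: eq_bigr => m _; rewrite mxE; ring.
have sum_cts (I : finType) (F : I -> 'rV[R]_d -> R) :
    (forall i, continuous (F i)) -> continuous (fun v => \sum_i F i v).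
  move=> cF; apply: continuous_big => // z.
  by apply: cvgD; [exact: cvg_fst|exact: cvg_snd].
have coordc k : continuous (fun v : 'rV[R]_d => v 0 k) by exact: coord_continuous.
have bc : continuous (fun v => b v v).
  apply/sum_cts => k; apply/sum_cts => m v.
  exact: (cvgM (cvgM (coordc k v) (coordc m v)) (cvg_cst _)).
have nc : continuous (fun v : 'rV[R]_d => \sum_k v 0 k ^+ 2).
  by apply: sum_cts => k v; exact: (cvgM (coordc k v) (coordc k v)).
pose S := [set v : 'rV[R]_d | \sum_k v 0 k ^+ 2 = 1].
have nS v : S v -> enorm v = 1 by rewrite /S/= /enorm => ->; exact: sqrtr1.
have cS : compact S.
  apply: bounded_closed_compact.
    exists 1; split; first exact: num_real.
    move=> x x1 v /= /nS v1; rewrite [leLHS]/Num.norm/= mx_normrE.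
    apply/bigmax_leP; split => [|[i k] _ /=]; first exact: (le_trans ler01 (ltW x1)).
    by rewrite (ord1 i) (le_trans (coord_le_enorm v k))// v1 ltW.
  rewrite (_ : S = (fun v : 'rV[R]_d => \sum_k v 0 k ^+ 2) @^-1` [set 1])//.
  apply: closed_comp => [v _|]; first exact: nc.
  exact: closed_eq.
have S0 : S !=set0.
  exists (\row_k (k == Ordinal d0)%:R); rewrite /S/= (bigD1 (Ordinal d0))//=.
  rewrite mxE eqxx expr1n big1 ?addr0// => k /negbTE kn.
  by rewrite mxE kn expr0n.
have [v0 v0S vmax] : exists2 c, c \in S & forall t, t \in S -> b t t <= b c c.
  by apply: EVT_max_rV => //; apply: continuous_subspaceT => v; exact: bc.
rewrite inE in v0S; pose la := b v0 v0.
have qle v : b v v <= la * enorm v ^+ 2.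
  have [->|vn] := eqVneq v 0.
    have z0 : 0 = 0 *: (0 : 'rV[R]_d) by rewrite scale0r.
    by rewrite z0 bZ mul0r enormZ normr0 mul0r expr0n mulr0.
  have n0 : 0 < enorm v.
    by rewrite lt_def enorm_ge0 andbT; apply: contra_neq vn => /enorm_eq0.
  have : (enorm v)^-1 *: v \in S.
    rewrite inE /S/=; under eq_bigr do rewrite mxE exprMn.
    by rewrite -mulr_sumr -sqr_enorm -exprMn mulVf ?expr1n ?gt_eqF.
  move=> /vmax; rewrite bZ bC bZ mulrA -expr2 exprVn ler_pdivrMl ?exprn_gt0//.
  by rewrite mulrC.
suff le : la <= lambda_max H.
  by move=> v; apply: (le_trans (qle v)); rewrite ler_wpM2r// sqr_ge0.
have sqE u : enorm u ^+ 2 = \sum_k u 0 k * u 0 k.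
  by rewrite sqr_enorm; apply: eq_bigr => k _; rewrite expr2.
(* [la * enorm v ^+ 2 - b v v] is nonnegative and vanishes at [v0], so its linear term in every
   direction [w] is zero. *)
have eig (w : 'rV[R]_d) : la * (\sum_k v0 0 k * w 0 k) = b v0 w.
  apply/eqP; rewrite -subr_eq0; apply/eqP.
  apply: (@linear_term_eq0 _ (la * enorm w ^+ 2 - b w w)) => [|z].
    by rewrite subr_ge0.
  have := qle (v0 + (- z) *: w); rewrite -subr_ge0; congr (0 <= _).
  have -> : b (v0 + - z *: w) (v0 + - z *: w) = la - 2 * z * b v0 w + z ^+ 2 * b w w.
    rewrite bD (bC (v0 + _) v0) (bC (v0 + _) (_ *: w)) !bD (bC (_ *: w) v0) bZ.
    by rewrite (bZ _ (_ *: w)) (bC (_ *: w) w) bZ /la; ring.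
  have -> : enorm (v0 + - z *: w) ^+ 2 =
      1 - 2 * z * (\sum_k v0 0 k * w 0 k) + z ^+ 2 * enorm w ^+ 2.
    rewrite !sqr_enorm -[X in X - _](_ : \sum_k v0 0 k ^+ 2 = 1)//.
    rewrite !mulr_sumr -sumrB -big_split/=; apply: eq_bigr => k _.
    by rewrite !mxE; ring.
  by rewrite mulrBr; ring.
have bdelta (u : 'rV[R]_d) m : b u (delta_mx 0 m) = \sum_k u 0 k * H m k.
  rewrite /b; apply: eq_bigr => k _; rewrite (bigD1 m)//= mxE !eqxx mulr1.
  by rewrite big1 ?addr0// => m' /negbTE mm; rewrite mxE mm andbF mulr0 mul0r.
have laE : eigenvalue H la.
  apply/eigenvalueP; exists v0.
    apply/rowP => m; rewrite !mxE.
    under eq_bigr do rewrite Hsym.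
    rewrite -bdelta -eig; congr (_ * _); rewrite (bigD1 m)//= mxE !eqxx mulr1.
    by rewrite big1 ?addr0// => m' /negbTE mm; rewrite mxE mm andbF mulr0.
  apply/eqP => z; move: v0S; rewrite /S/= z big1 => [/eqP|k _].
    by rewrite eq_sym oner_eq0.
  by rewrite mxE expr0n.
(* The set of eigenvalues must be bounded for its [sup] to dominate [la]; each eigenvalue is a
   Rayleigh quotient, so [la] is a bound. *)
apply: ub_le_sup => //; exists la => a /eigenvalueP[v vH vn].
have n0 : 0 < enorm v ^+ 2.
  rewrite exprn_gt0// lt_def enorm_ge0 andbT.
  by apply: contra_neq vn => /enorm_eq0.
rewrite -(ler_pM2r n0); apply: le_trans (qle v); rewrite sqE mulr_sumr.
rewrite /b exchange_big/= le_eqVlt; apply/orP; left; apply/eqP.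
apply: eq_bigr => m _; have := congr1 (fun w : 'rV[R]_d => w 0 m) vH; rewrite !mxE => E.
rewrite mulrA -E mulr_suml; apply: eq_bigr => k _.
by rewrite (Hsym m k) mulrAC.
Qed.

End hessian_at_maximum.

(** * Homogeneous parts of the Taylor polynomial and its quadratic decay at the maximum *)

Section taylor_at_maximum.
Variables (R : realType) (d : nat).
Implicit Types (A D : set 'rV[R]_d) (f : 'rV[R]_d -> R) (x y u v : 'rV[R]_d).

Definition mdeg r (i : mindex d r) : nat := (\sum_(k < d) i k)%N.

Definition hpart r (c : mindex d r -> R) (s : nat) v : R :=
  \sum_(i : mindex d r | mdeg i == s) c i * mpow v i.

Lemma hpart_homog r (c : mindex d r -> R) s t v :
  hpart c s (t *: v) = t ^+ s * hpart c s v.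
Proof.
rewrite /hpart mulr_sumr; apply: eq_bigr => i /eqP <-.
by rewrite mpow_homog mulrCA.
Qed.

Lemma poly_eval_hpart3 r (c : mindex d r -> R) : exists2 C : R, 0 < C &
  forall v, enorm v <= 1 ->
  `|poly_eval c v - (hpart c 0 v + hpart c 1 v + hpart c 2 v)| <= C * enorm v ^+ 3.
Proof.
exists (1 + \sum_i `|c i|) => [|v v1]; first by rewrite ltr_pwDl// sumr_ge0.
rewrite /poly_eval /hpart (bigID (fun i => mdeg i == 0%N))/=.
rewrite [X in _ + X - _](bigID (fun i => mdeg i == 1%N))/=.
rewrite [X in _ + (_ + X) - _](bigID (fun i => mdeg i == 2%N))/=.
rewrite [X in _ + (X + _) - _](eq_bigl (fun i : mindex d r => mdeg i == 1%N)); last first.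
  by move=> i; case: (mdeg i) => [|[|]].
rewrite [X in _ + (_ + (X + _)) - _](eq_bigl (fun i : mindex d r => mdeg i == 2%N)); last first.
  by move=> i; case: (mdeg i) => [|[|[|]]].
set a0 := \sum_(_ | _) _; set a1 := \sum_(_ | _) _; set a2 := \sum_(_ | _) _.
set a3 := \sum_(_ | _) _.
have -> : a0 + (a1 + (a2 + a3)) - (a0 + a1 + a2) = a3 by ring.
apply: (le_trans (ler_norm_sum _ _ _)).
apply: (@le_trans _ _ (\sum_i `|c i| * enorm v ^+ 3)); last first.
  rewrite -mulr_suml ler_wpM2r ?exprn_ge0 ?enorm_ge0// lerDr//.
rewrite big_mkcond/=; apply: ler_sum => i _; case: ifPn => [|_]; last first.
  by rewrite mulr_ge0// exprn_ge0// enorm_ge0.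
move=> /andP[/andP[i0 i1] i2]; rewrite normrM ler_wpM2l//.
rewrite (le_trans (mpow_bound (mindex_fun i) (coord_le_enorm v)))//.
apply: ler_wiXn2l => //; first exact: enorm_ge0.
by move: i0 i1 i2; rewrite /mdeg; case: (\sum_(k < d) _)%N => [|[|[|]]].
Qed.

Definition taylor_coef A r f x0 (i : mindex d r) : R :=
  (mfact i)%:R^-1 * mpartial A i f x0.

Lemma taylorE A r f x0 x :
  taylor A r f x0 x = poly_eval (@taylor_coef A r f x0) (x - x0) :> R.
Proof. by []. Qed.

Lemma taylor_coef_hpart0 A r f x0 v : hpart (@taylor_coef A r f x0) 0 v = f x0.
Proof.
have [i iE] : exists m : mindex d r, forall k, m k = (fun=> 0%N) k.
  by apply: mindex_exists; rewrite big1.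
rewrite /hpart (bigD1 i)/=; last by rewrite /mdeg big1.
rewrite big1 ?addr0 => [|j /andP[j0 ji]].
  have -> : mpow v i = 1 by rewrite /mpow big1// => k _; rewrite iE.
  rewrite mulr1 /taylor_coef /mfact big1 ?invr1 ?mul1r => [|k _]; last by rewrite iE.
  rewrite /mpartial; elim: (enum _) => //= k s ihs.
  by rewrite iE.
case/eqP: ji; apply: mindex_inj => k; rewrite iE.
by move: j0; rewrite /mdeg sum_nat_eq0 => /forallP/(_ k)/eqP.
Qed.

Lemma powR_le_sqr (alpha L e : R) : 2 < alpha -> 0 < L -> 0 < e ->
  exists2 r : R, 0 < r & forall x : R, 0 <= x < r -> L * x `^ alpha <= e * x ^+ 2.
Proof.
move=> a2 L0 e0; have a20 : 0 < alpha - 2 by lra.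
exists ((e / L) `^ (alpha - 2)^-1) => [|x /andP[x0 xr]].
  exact/powR_gt0/divr_gt0.
have [->|xn] := eqVneq x 0.
  by rewrite expr0n mulr0 powR0 ?mulr0//; apply/eqP; lra.
have xp : 0 < x by rewrite lt_def xn.
rewrite (_ : alpha = 2 + (alpha - 2)); last by ring.
rewrite powRD; last by rewrite xn implybT.
rewrite powR_mulrn// mulrCA mulrC ler_wpM2r ?sqr_ge0// mulrC -ler_pdivlMr//.
apply: (@le_trans _ _ (((e / L) `^ (alpha - 2)^-1) `^ (alpha - 2))).
  by apply: ge0_ler_powR; rewrite ?nnegrE ?powR_ge0// ltW.
by rewrite -powRrM mulVf ?gt_eqF// powRr1// divr_ge0// ltW.
Qed.

Lemma enorm_sub_interior A x : A° x ->
  exists2 r : R, 0 < r & forall y, enorm y < r -> A (x + y).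
Proof.
move=> /nbhs_enorm[r r0 rA]; exists r => // y yr; apply: rA.
by rewrite addrC addKr.
Qed.

Lemma taylor_second_order A r f alpha L x :
  2 < alpha -> 0 < L -> A° x ->
  (forall y, A y -> `|f y - taylor A r f x y| <= L * enorm (y - x) `^ alpha) ->
  forall e, 0 < e -> exists2 rho : R, 0 < rho & forall y, enorm y < rho ->
    `|f (x + y) - (f x + (hpart (@taylor_coef A r f x) 1 y +
                          hpart (@taylor_coef A r f x) 2 y))| <= e * enorm y ^+ 2.
Proof.
move=> a2 L0 Ax fT e e0; set c := @taylor_coef A r f x.
have [C C0 CP] := poly_eval_hpart3 c.
have e20 : 0 < e / 2 by rewrite divr_gt0.
have [r1 r10 r1A] := enorm_sub_interior Ax.
have [r2 r20 r2P] := powR_le_sqr a2 L0 e20.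
pose r3 := Num.min 1 (e / 2 / C).
have r30 : 0 < r3 by rewrite lt_min ltr01 divr_gt0.
exists (Num.min r1 (Num.min r2 r3)) => [|y]; first by rewrite !lt_min r10 r20 -lt_min.
rewrite !lt_min => /and4P[y1 y2 y3 y4].
have := fT _ (r1A _ y1); rewrite taylorE (_ : x + y - x = y) -/c => [H1|];
  last by rewrite addrC addKr.
have := CP y (ltW y3); rewrite taylor_coef_hpart0 => H2.
have H3 : L * enorm y `^ alpha <= e / 2 * enorm y ^+ 2.
  by apply: r2P; rewrite enorm_ge0.
have H4 : C * enorm y ^+ 3 <= e / 2 * enorm y ^+ 2.
  rewrite exprSr mulrCA mulrC ler_wpM2r ?sqr_ge0// mulrC -ler_pdivlMr//.
  exact: ltW.
move: H1 H2; set h1 := hpart _ 1 _; set h2 := hpart _ 2 _.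
set P := poly_eval _ _; rewrite !ler_norml => /andP[a b] /andP[a' b'].
by apply/andP; split; lra.
Qed.

Lemma taylor_linear_eq0 A D r f alpha L x :
  2 < alpha -> 0 < L -> A° x -> D° x -> is_argmax_on D f x ->
  (forall y, A y -> `|f y - taylor A r f x y| <= L * enorm (y - x) `^ alpha) ->
  forall v, hpart (@taylor_coef A r f x) 1 v = 0.
Proof.
move=> a2 L0 Ax Dx [_ fmax] fT.
set T1 := hpart _ 1; set T2 := hpart (@taylor_coef A r f x) 2.
(* [T1] is odd, so one sign suffices. *)
suff le0 v : T1 v <= 0.
  move=> v; apply/eqP; rewrite eq_le le0 -oppr_le0 -mulN1r -[-1]expr1 -hpart_homog.
  exact: le0.
have [r1 r10 r1D] := enorm_sub_interior Dx.
have [r2 r20 r2P] := taylor_second_order a2 L0 Ax fT ltr01.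
apply/ler_addgt0Pr => e e0; rewrite add0r.
(* [K] collects the second-order terms: maximality along [t *: v] gives [t * T1 v <= t ^+ 2 * K],
   and [t] is taken small. *)
pose K := 1 + `|T2 v| + enorm v ^+ 2.
have K0 : 0 < K by have := normr_ge0 (T2 v); have := sqr_ge0 (enorm v); rewrite /K; lra.
have N0 : 0 < 1 + enorm v by have := enorm_ge0 v; lra.
pose m := Num.min (e / K) (Num.min r1 r2 / (1 + enorm v)).
have m0 : 0 < m by rewrite lt_min !divr_gt0// lt_min r10.
pose t := m / 2; have t0 : 0 < t by rewrite divr_gt0.
have : t < m by rewrite /t; lra.
rewrite lt_min !ltr_pdivlMr// => /andP[te tr].
have tv : enorm (t *: v) < Num.min r1 r2.
  by rewrite enormZ gtr0_norm//; apply: le_lt_trans tr; rewrite ler_wpM2l ?(ltW t0)// lerDr.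
move: tv; rewrite lt_min => /andP[tv1 tv2].
have := fmax _ (r1D _ tv1); have := r2P _ tv2.
rewrite !hpart_homog -/T1 -/T2 expr1 enormZ (gtr0_norm t0) ler_norml => /andP[b _] c.
have T2v := ler_norm (- T2 v); rewrite normrN in T2v.
have : t * T1 v <= t * (t * K) by rewrite /K exprMn in b *; nra.
by rewrite ler_pM2l// => /le_trans; apply; exact: ltW.
Qed.

(** The linear part vanishes, and the quadratic part, half the Hessian form, is at most [- (c / 2)]
    times the square. Half of this gap absorbs the higher terms near [x]. *)
Theorem taylor_quadratic_upper_bound A D r f alpha L x :
  (0 < d)%N -> 2 < alpha -> 0 < L -> A° x -> D° x -> is_argmax_on D f x ->
  ndifferentiable A 2 f -> lambda_max (hessian A f x) < 0 ->
  (forall y, A y -> `|f y - taylor A r f x y| <= L * enorm (y - x) `^ alpha) ->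
  exists c rho : R, [/\ 0 < c, 0 < rho & forall y, enorm (y - x) <= rho ->
    taylor A r f x y <= f x - c * enorm (y - x) ^+ 2].
Proof.
move=> d0 a2 L0 Ax Dx fmax fA lneg fT.
pose c := - lambda_max (hessian A f x); have c0 : 0 < c by rewrite oppr_gt0.
set T := @taylor_coef A r f x.
have T1 v := taylor_linear_eq0 a2 L0 Ax Dx fmax fT v.
have Hsym k m : hessian A f x k m = hessian A f x m k.
  have hdelta p q : hform A f x (delta_mx 0 p) (delta_mx 0 q) = hessian A f x q p.
    rewrite /hform (bigD1 p)//= (bigD1 q)//= !mxE !eqxx !mul1r.
    rewrite [X in _ + X + _]big1 ?addr0 => [|i /negbTE iq]; last first.
      by rewrite !mxE iq andbF mulr0 mul0r.
    rewrite big1 ?addr0// => i /negbTE ip.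
    by rewrite big1// => j _; rewrite mxE ip andbF !mul0r.
  by rewrite -!hdelta; exact: hform_sym.
have T2 v : hpart T 2 v <= - (c / 2) * enorm v ^+ 2.
  have := lambda_max_bound d0 Hsym v; rewrite -/(hform A f x v v).
  rewrite (@hform_quadratic _ _ _ _ _ (hpart T 2))//.
  - by rewrite /c; lra.
  - by move=> t y; rewrite hpart_homog.
  move=> e e0; have [rho rho0 H] := taylor_second_order a2 L0 Ax fT e0.
  by exists rho => // y /H; rewrite T1 add0r.
have [C C0 CP] := poly_eval_hpart3 T.
exists (c / 4), (Num.min 1 (c / 4 / C)); split.
- by rewrite divr_gt0.
- by rewrite lt_min ltr01 !divr_gt0.
move=> y; rewrite le_min taylorE -/T => /andP[y1 y2].
have := CP _ y1; rewrite taylor_coef_hpart0 T1 addr0 ler_norml => /andP[_].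
have := T2 (y - x); move: y2; rewrite ler_pdivlMr// => y2.
have := ler_wpM2l (sqr_ge0 (enorm (y - x))) y2; rewrite (exprSr _ 2).
by set n := enorm _; set P := poly_eval _ _; set Q := hpart _ _ _; lra.
Qed.

End taylor_at_maximum.

(** * Argmax of a perturbed polynomial *)

(* Comparing [p m >= p mu] on the rescaled cube: the quadratic gap of [T] at
   [m] is at most the increment of [q], which is Lipschitz with constant of
   order [delta `^ alpha] in the rescaled variable. *)
Lemma perturbed_argmax_rate (R : realType) (d r l : nat) (T : 'rV[R]_d -> R)
    (mu : 'rV[R]_d) (c rho alpha K : R) :
  (0 < l)%N -> 0 < c -> 0 < rho -> 0 < K ->
  (forall y, enorm (y - mu) <= rho -> T y <= T mu - c * enorm (y - mu) ^+ 2) ->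
  exists K' delta0 : R, [/\ 0 < K', 0 < delta0 &
    forall (delta : R) (a m : 'rV[R]_d) (p : 'rV[R]_d -> R) (q : mindex d r -> R),
    0 < delta < delta0 -> (forall k, `|mu 0 k - a 0 k| <= delta) ->
    (forall i, `|q i| <= K * delta `^ alpha) ->
    (forall u, p (a + delta *: u) = T (a + delta *: u) + poly_eval q u) ->
    is_argmax_on (cube a (l%:R * delta)) p m ->
    enorm (m - mu) <= K' * delta `^ (alpha - 1) /\
    `|p m - T mu| <= K' * delta `^ alpha].
Proof.
move=> l0 c0 rho0 K0 Tmax.
have l1 : 1 <= l%:R :> R by rewrite ler1n.
have [C1 C10 lip] := @poly_eval_lipschitz R d r _ l1.
have [C2 C20 bnd] := @poly_eval_bound R d r _ l1.
have N0 : 0 < d%:R * (l%:R + 1) + 1 :> R.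
  by rewrite ltr_pwDr// mulr_ge0// addr_ge0.
(* The first summand serves the distance and the second the value. The bound on [delta] puts the
   whole cube within [rho] of [mu]. *)
exists (C1 * K / c + C2 * K), (rho / (d%:R * (l%:R + 1) + 1)); split.
- by rewrite addr_gt0 ?divr_gt0 ?mulr_gt0.
- by rewrite divr_gt0.
move=> delta a m p q /andP[d0 dd0] amu qb pE [mcube mmax].
have dn0 : delta != 0 by rewrite gt_eqF.
pose resc (y : 'rV[R]_d) := delta^-1 *: (y - a).
have rescK y : a + delta *: resc y = y.
  by rewrite /resc scalerA mulfV// scale1r addrC subrK.
have resc_bound (y : 'rV[R]_d) (s : R) : (forall k, `|y 0 k - a 0 k| <= s * delta) ->
    forall k, `|resc y 0 k| <= s.
  move=> ys k; rewrite !mxE normrM normfV (gtr0_norm d0) ler_pdivrMl// mulrC.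
  exact: ys.
have m_near k : `|m 0 k - a 0 k| <= l%:R * delta.
  by rewrite ler_distl; exact: mcube.
have mu_near k : `|mu 0 k - a 0 k| <= l%:R * delta.
  by rewrite (le_trans (amu k))// ler_peMl// ltW.
have mu_cube : cube a (l%:R * delta) mu by move=> k; rewrite -ler_distl.
have ub := resc_bound _ _ m_near; have vb := resc_bound _ _ mu_near.
have pm : p m = T m + poly_eval q (resc m) by rewrite -{1}(rescK m) pE rescK.
have pmu : p mu = T mu + poly_eval q (resc mu) by rewrite -{1}(rescK mu) pE rescK.
have := mmax _ mu_cube; rewrite pm pmu => le_p.
set n := enorm (m - mu).
have n_rho : n <= rho.
  apply: (@le_trans _ _ (d%:R * ((l%:R + 1) * delta))).
    apply: enorm_le_bound => k; rewrite !mxE.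
    rewrite -(subrKA (a 0 k)) (le_trans (ler_normD _ _))// mulrDl mul1r.
    by apply: lerD => //; rewrite distrC.
  rewrite mulrA; move: dd0; rewrite ltr_pdivlMr//; lra.
have Tm := Tmax _ n_rho; rewrite -/n in Tm.
have n0 : 0 <= n by exact: enorm_ge0.
set e := K * delta `^ alpha in qb.
have dal : delta `^ alpha = delta `^ (alpha - 1) * delta.
  rewrite -[X in _ * X]powRr1 ?(ltW d0)// -powRD ?subrK//.
  by rewrite dn0 implybT.
split.
  have [->|nn] := eqVneq n 0.
    by rewrite mulr_ge0// ?powR_ge0// addr_ge0// ?divr_ge0// ?mulr_ge0// ltW.
  have np : 0 < n by rewrite lt_def nn.
  have := lip q e _ _ qb ub vb.
  have -> : resc m - resc mu = delta^-1 *: (m - mu).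
    by rewrite /resc -scalerBr opprB addrA subrK.
  rewrite enormZ normfV (gtr0_norm d0) -/n => H.
  have : c * n ^+ 2 <= C1 * e * (delta^-1 * n).
    by have := le_trans (ler_norm _) H; lra.
  rewrite expr2 !mulrA ler_pM2r// mulrC -ler_pdivlMr// => /le_trans; apply.
  rewrite /e dal (_ : _ / c = C1 * K / c * delta `^ (alpha - 1)).
    by rewrite ler_wpM2r ?powR_ge0// lerDl mulr_ge0// ltW.
  by field; rewrite dn0 gt_eqF.
have b1 := bnd _ _ _ qb ub; have b2 := bnd _ _ _ qb vb.
apply: (@le_trans _ _ (C2 * e)); last first.
  rewrite /e mulrA ler_wpM2r ?powR_ge0// lerDr.
  by rewrite divr_ge0// ?mulr_ge0// ltW.
(* The value is squeezed: [T m <= T mu] bounds it above by the perturbation at [m], and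
   [p mu <= p m] below by the perturbation at [mu]. *)
move: b1 b2; rewrite !ler_norml => /andP[? ?] /andP[? ?].
have := mulr_ge0 (ltW c0) (sqr_ge0 n).
by move=> ?; apply/andP; split; lra.
Qed.

(** * Independence, measurability and stochastic order *)

Section uncorrelated_sums.
Context {disp : measure_display} {Om : measurableType disp} {R : realType}.
Variable P : probability Om R.

Definition independent_pair (X Y : Om -> R) : Prop :=
  forall A B : set R, measurable A -> measurable B ->
    P (X @^-1` A `&` Y @^-1` B) = (P (X @^-1` A) * P (Y @^-1` B))%E.

Lemma mutually_independent_pair (I : finType) (X : I -> Om -> R) (i j : I) :
  mutually_independent P X -> i != j -> independent_pair (X i) (X j).
Proof.
move=> indX ij A B mA mB.
pose C k : set R := if k == i then A else if k == j then B else setT.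
have mC k : measurable (C k) by rewrite /C; case: ifP => // _; case: ifP.
have Ci : C i = A by rewrite /C eqxx.
have Cj : C j = B by rewrite /C eq_sym (negbTE ij) eqxx.
have := indX C mC.
have -> : \bigcap_(k in [set: I]) X k @^-1` C k = X i @^-1` A `&` X j @^-1` B.
  apply/seteqP; split => [w h|w [wA wB] k _].
    by split; [have := h i Logic.I; rewrite /= Ci|have := h j Logic.I; rewrite /= Cj].
  by rewrite /= /C; case: eqP => [->//|_]; case: eqP => [->//|_].
move=> ->; rewrite (bigD1 i)//= (bigD1 j)//=; last by rewrite eq_sym.
rewrite Ci Cj big1 ?mule1// => k /andP[ki kj].
by rewrite /C (negbTE ki) (negbTE kj) preimage_setT probability_setT.
Qed.

Lemma Lfun_mfun (p : \bar R) (X : Om -> R) : X \in Lfun P p -> measurable_fun setT X.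
Proof. by rewrite inE => /andP[]; rewrite inE. Qed.

(* The joint law of an independent pair is the product of the marginal laws,
   so Fubini applies. *)
Lemma expectation_mul_independent (X Y : {RV P >-> R}) :
  (X : Om -> R) \in Lfun P 2%:E -> (Y : Om -> R) \in Lfun P 2%:E ->
  independent_pair X Y -> ('E_P[X \* Y] = 'E_P[X] * 'E_P[Y])%E.
Proof.
move=> X2 Y2 indXY.
have Pfin : P setT \is a fin_num := fin_num_measure P _ measurableT.
have X1 := (Lfun1_integrable P X).1 (Lfun_subset12 Pfin X2).
have Y1 := (Lfun1_integrable P Y).1 (Lfun_subset12 Pfin Y2).
have XY1 := (Lfun1_integrable P (X \* Y)).1 (Lfun2_mul_Lfun1 X2 Y2).
pose Z (w : Om) : R * R := (X w, Y w).
have mZ : measurable_fun setT Z by exact: measurable_fun_pair.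
pose Zm : {RV P >-> (R * R)%type} :=
  MeasurableFun.Pack (MeasurableFun.Class (isMeasurableFun.Build _ _ _ _ _ mZ)).
pose g (z : R * R) : \bar R := (z.1 * z.2)%:E.
have mg : measurable_fun setT g.
  by apply/measurable_EFinP; exact: measurable_funM.
have prodE A : measurable A ->
    (distribution P X \x distribution P Y)%E A = distribution P Zm A.
  move=> mA; apply: product_measure_unique mA => B C mB mC.
  by rewrite /distribution /pushforward /= -indXY.
have intg : (distribution P X \x distribution P Y)%E.-integrable setT g.
  have /integrableP[_ fin] : (distribution P Zm).-integrable setT g.
    exact: integrable_pushforward.
  apply/integrableP; split => //; apply: le_lt_trans fin.
  by rewrite (eq_measure_integral (distribution P Zm))// => A mA _; exact: prodE.
have intX : (distribution P X).-integrable setT (EFin : R -> \bar R).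
  by apply: integrable_pushforward => //; exact/measurable_EFinP.
have intY : (distribution P Y).-integrable setT (EFin : R -> \bar R).
  by apply: integrable_pushforward => //; exact/measurable_EFinP.
have EX : 'E_P[X]%E = (\int[distribution P X]_x x%:E)%E.
  by rewrite integral_distribution// ?unlock//; exact/measurable_EFinP.
have EY : 'E_P[Y]%E = (\int[distribution P Y]_x x%:E)%E.
  by rewrite integral_distribution// ?unlock//; exact/measurable_EFinP.
have fEY : 'E_P[Y]%E \is a fin_num by rewrite expectation_fin_num// Lfun_subset12.
transitivity (\int[distribution P Zm]_z g z)%E.
  by rewrite integral_distribution// unlock.
rewrite (eq_measure_integral (distribution P X \x distribution P Y)%E); last first.
  by move=> A mA _; rewrite [RHS]prodE.
rewrite -integral12_prod_meas1// /fubini_F.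
transitivity (\int[distribution P X]_x (x%:E * 'E_P[Y]))%E.
  apply: eq_integral => x _; rewrite /g/= EY -integralZl//.
by rewrite -(fineK fEY) integralZr// -EX.
Qed.

(** For a centred variable the variance is the second moment, so its finiteness already gives square
    integrability. *)
Lemma Lfun2_of_variance (X : {RV P >-> R}) (s : R) :
  'E_P[X]%E = 0%E -> 'V_P[X]%E = s%:E -> (X : Om -> R) \in Lfun P 2%:E.
Proof.
move=> EX; rewrite /variance unlock EX /= => VX.
rewrite inE; apply/andP; split; first by rewrite inE/=; exact: measurable_funPT.
rewrite inE/= /finite_norm unlock /= poweR_lty//.
rewrite (_ : integral _ _ _ = s%:E) ?ltry// -VX unlock.
apply: eq_integral => w _ /=.
by rewrite [X in (X w)%:E]/GRing.mul/= subr0 powR_mulrn// real_normK ?num_real// expr2.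
Qed.

(** Pairwise independence makes covariances vanish, so variances add along a duplicate-free list. *)
Lemma chebyshev_sum_independent (I : finType) (X : I -> {RV P >-> R}) (s t : R) :
  (forall i j, i != j -> independent_pair (X i) (X j)) ->
  (forall i, 'E_P[X i]%E = 0%E) -> (forall i, 'V_P[X i]%E = s%:E) -> 0 < t ->
  (P [set w | (t <= `|\sum_i X i w|)%R] <= (#|I|%:R * s / t ^+ 2)%:E)%E.
Proof.
move=> indX EX VX t0.
have X2 i : (X i : Om -> R) \in Lfun P 2%:E by exact: Lfun2_of_variance (EX i) (VX i).
have Pfin : P setT \is a fin_num := fin_num_measure P _ measurableT.
have covX i j : i != j -> covariance P (X i) (X j) = 0%E.
  move=> ij; rewrite covarianceE ?Lfun2_mul_Lfun1 ?(Lfun_subset12 Pfin)//.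
  rewrite [X in (X - _)%E](expectation_mul_independent (X2 i) (X2 j) (indX _ _ ij)).
  by rewrite EX mul0e sube0.
pose S (r : seq I) := fun w => \sum_(i <- r) X i w.
have S_cons i r : S (i :: r) = X i \+ S r by apply/funext => w; rewrite /S big_cons.
have S_nil : S [::] = cst 0 by apply/funext => w; rewrite /S big_nil.
have S2 r : S r \in Lfun P 2%:E.
  elim: r => [|i r ihr]; first by rewrite S_nil; exact: Lfun_cst.
  by rewrite S_cons rpredD//= lee1n.
have ES r : 'E_P[S r]%E = 0%E.
  elim: r => [|i r ihr]; first by rewrite S_nil expectation_cst.
  by rewrite S_cons expectationD ?(Lfun_subset12 Pfin)// EX ihr adde0.
have covS j r : j \notin r -> covariance P (X j) (S r) = 0%E.
  elim: r => [|i r ihr]; first by rewrite S_nil covariance_cst_r.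
  rewrite inE negb_or => /andP[ji jr].
  by rewrite S_cons covarianceDr// covX// ihr// adde0.
have VS r : uniq r -> 'V_P[S r]%E = ((size r)%:R * s)%:E.
  elim: r => [_|i r ihr /= /andP[ir ur]]; first by rewrite S_nil variance_cst mul0r.
  rewrite S_cons varianceD// VX ihr// covS// mule0 adde0 -EFinD.
  by rewrite -[(size r).+1%:R]natr1 mulrDl mul1r addrC.
have mS : measurable_fun setT (S (enum I)) by exact: Lfun_mfun (S2 _).
pose Sm : {RV P >-> R} :=
  MeasurableFun.Pack (MeasurableFun.Class (isMeasurableFun.Build _ _ _ _ _ mS)).
have := chebyshev Sm t0; rewrite [Sm : Om -> R]/(S _).
rewrite ES VS ?enum_uniq// -cardE /= => h; apply: le_trans (le_trans h _).
  rewrite le_eqVlt; apply/orP; left; apply/eqP; congr (P _).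
  by apply/seteqP; split => w /=; rewrite /S/= subr0 big_enum.
by rewrite -EFinM lee_fin mulrC.
Qed.

End uncorrelated_sums.

(** * Measurability of a function observed at random points *)

Section measurability.
Context {disp : measure_display} {Om : measurableType disp} {R : realType}.
Variable d : nat.

Lemma measurable_set_lt (X : Om -> R) (a : R) :
  measurable_fun setT X -> measurable [set w | a < X w].
Proof.
move=> mX; rewrite (_ : [set w | a < X w] = setT `&` X @^-1` `]a, +oo[%classic).
  by apply: mX => //; exact: measurable_itv.
by rewrite setTI; apply/seteqP; split => w /=; rewrite in_itv/= andbT.
Qed.

(* The superlevel sets of [f \o g] are countable unions of preimages under [g]
   of rational boxes. *)
Lemma measurable_comp_continuous_within (A : set 'rV[R]_d) (f : 'rV[R]_d -> R)
    (g : Om -> 'rV[R]_d) :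
  (forall x e, A x -> 0 < e -> exists2 r : R, 0 < r &
     forall y, A y -> enorm (y - x) < r -> `|f y - f x| < e) ->
  (forall k, measurable_fun setT (fun w => g w 0 k)) -> (forall w, A (g w)) ->
  measurable_fun setT (fun w => f (g w)).
Proof.
move=> fc mg gA; apply: (measurability _ (RGenOInfty.measurableE R)) => //.
move=> _ [_ [a ->] <-]; rewrite setTI.
pose box (q : {ffun 'I_d -> rat}) (n : nat) (y : 'rV[R]_d) :=
  forall k, `|y 0 k - ratr (q k)| < n.+1%:R^-1.
pose good (p : {ffun 'I_d -> rat} * nat) := forall y, A y -> box p.1 p.2 y -> a < f y.
pose F p := if `[< good p >] then [set w | box p.1 p.2 (g w)] else set0.
rewrite (_ : _ @^-1` _ = \bigcup_p F p).
  apply: countable_bigcupT_measurable => [|p]; first exact: countableP.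
  rewrite /F; case: ifP => // _.
  rewrite (_ : [set w | _] =
      \bigcap_(k in [set: 'I_d]) [set w | `|g w 0 k - ratr (p.1 k)| < p.2.+1%:R^-1]).
    apply: fin_bigcap_measurable => // k _.
    rewrite (_ : [set w | _] = [set w | - p.2.+1%:R^-1 < - `|g w 0 k - ratr (p.1 k)|]).
      apply: measurable_set_lt; apply: measurableT_comp => //.
      by apply: measurableT_comp => //; apply: measurable_funB.
    by apply/seteqP; split => w /=; rewrite ltrN2.
  by apply/seteqP; split => [w h k _|w h k]; exact: h.
apply/seteqP; split => [w /=|w [p _]]; last first.
  rewrite /F; case: ifPn => // /asboolP gp /gp.
  by rewrite /= in_itv/= andbT; apply.
rewrite in_itv/= andbT => aw; have e0 : 0 < f (g w) - a by rewrite subr_gt0.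
have [r r0 rP] := fc _ _ (gA w) e0.
(* Two points of a box of half-width [n.+1%:R^-1] are at distance at most [2 * d / n.+1]. *)
have N0 : 0 < r / (2 * d%:R + 1) by rewrite divr_gt0// ltr_pwDr// mulr_ge0.
have [n nr] : exists n : nat, n.+1%:R^-1 < r / (2 * d%:R + 1).
  have [n /= _ H] := near_infty_natSinv_lt (PosNum N0).
  by exists n; exact: (H n (leqnn n)).
have n0 : 0 < n.+1%:R^-1 :> R by rewrite invr_gt0.
have /choice[q qP] : forall k, exists q : rat, `|g w 0 k - ratr q| < n.+1%:R^-1.
  move=> k; have [|q] := @rat_in_itvoo R (g w 0 k) (g w 0 k + n.+1%:R^-1).
    by rewrite ltrDl.
  rewrite in_itv/= => /andP[q1 q2]; exists q.
  by rewrite distrC gtr0_norm ?subr_gt0// ltrBlDl.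
exists ([ffun k => q k], n) => //; rewrite /F; case: ifPn => [_ k|/asboolP[]].
  by rewrite ffunE.
move=> y Ay yb; have : `|f y - f (g w)| < f (g w) - a.
  apply: rP => //; apply: (@le_lt_trans _ _ (d%:R * (2 * n.+1%:R^-1))).
    apply: enorm_le_bound => k; rewrite !mxE.
    rewrite -(subrKA (ratr (q k))) (le_trans (ler_normD _ _))// mulr_natl mulr2n.
    apply: lerD; first by have := yb k; rewrite ffunE => /ltW.
    by rewrite distrC ltW.
  move: nr; rewrite ltr_pdivlMr; last by rewrite ltr_pwDr// mulr_ge0.
  by apply: le_lt_trans; move: (n.+1%:R^-1) n0 => i i0; lra.
by rewrite ltr_distl => /andP[]; rewrite subKr.
Qed.

End measurability.

(** * Deterministic error bound for the two-stage estimator *)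

Section two_stage_bound.
Variables (R : realType) (d : nat).
Implicit Types (A D : set 'rV[R]_d) (f : 'rV[R]_d -> R) (x y : 'rV[R]_d).

Lemma taylor_at_center alpha L A r f x : 0 < alpha -> A x ->
  (forall y, A y -> `|f y - taylor A r f x y| <= L * enorm (y - x) `^ alpha) ->
  taylor A r f x x = f x.
Proof.
move=> a0 Ax fT; apply/eqP; rewrite eq_sym -subr_eq0 -normr_le0.
by apply: (le_trans (fT _ Ax)); rewrite subrr enorm0 powR0 ?mulr0// gt_eqF.
Qed.

(** Near [x] the Taylor increment is Lipschitz and the remainder is at most quadratic. Continuity
    makes the observations at random design points measurable. *)
Lemma holder_continuous alpha L A r f x : 2 < alpha -> 0 < L -> A x ->
  (forall y, A y -> `|f y - taylor A r f x y| <= L * enorm (y - x) `^ alpha) ->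
  forall e, 0 < e -> exists2 rho : R, 0 < rho &
    forall y, A y -> enorm (y - x) < rho -> `|f y - f x| < e.
Proof.
move=> a2 L0 Ax fT e e0.
have [C C0 lip] := @poly_eval_lipschitz R d r 1 (lexx _).
have [r1 r10 r1P] := powR_le_sqr a2 L0 ltr01.
pose c := @taylor_coef R d A r f x; pose s := \sum_i `|c i|.
have s0 : 0 <= s by exact: sumr_ge0.
have N0 : 0 < 1 + C * s by rewrite ltr_pwDl// mulr_ge0// ltW.
exists (Num.min (Num.min 1 r1) (e / (1 + C * s))) => [|y Ay].
  by rewrite !lt_min ltr01 r10 divr_gt0.
rewrite !lt_min => /andP[/andP[y1 yr] ye].
have n0 := enorm_ge0 (y - x).
have cs i : `|c i| <= s by rewrite /s (bigD1 i)//= lerDl sumr_ge0.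
have b1 k : `|(y - x) 0 k| <= 1 by exact: le_trans (coord_le_enorm _ _) (ltW y1).
have b2 k : `|(0 : 'rV[R]_d) 0 k| <= 1 by rewrite mxE normr0.
have := lip c s _ _ cs b1 b2.
rewrite subr0 (_ : poly_eval c 0 = f x) => [H1|]; last first.
  by rewrite -(taylor_at_center _ Ax fT) ?taylorE ?subrr//; lra.
have := fT _ Ay; rewrite taylorE -/c => H2.
have H3 : L * enorm (y - x) `^ alpha <= 1 * enorm (y - x) ^+ 2 by apply: r1P; rewrite n0.
have H4 : enorm (y - x) ^+ 2 <= enorm (y - x) by rewrite expr2 ler_piMr// ltW.
rewrite -(subrKA (poly_eval c (y - x))) (le_lt_trans (ler_normD _ _))//.
rewrite ltr_pdivlMr// in ye; lra.
Qed.

(** A polynomial of degree at most [r] fits its own grid values with zero residual, hence is their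
    least squares fit with one replicate. *)
Lemma taylor_fit r l (A : set 'rV[R]_d) f x (B : mindex d r -> grid d l -> R)
    a t (c : mindex d r -> R) :
  least_squares_matrix B -> t != 0 ->
  (forall u, taylor A r f x (a + t *: u) = poly_eval c u) ->
  forall i, c i = \sum_j B i j * taylor A r f x (grid_point a t j).
Proof.
move=> BE t0 cE i.
have [th thE] := poly_eval_affine (@taylor_coef R d A r f x) (- x) 1.
have thT y : poly_eval th y = taylor A r f x y.
  by rewrite -thE taylorE scale1r addrC.
rewrite (BE 1%N a t (fun k => taylor A r f x (grid_point a t k.1)) th c)//.
- by apply: eq_bigr => j _ /=; rewrite big_ord1 invr1 mul1r.
- move=> th'; rewrite {1}/sse big1 => [|k _]; last by rewrite thT subrr expr0n.
  by apply: sumr_ge0 => k _; exact: sqr_ge0.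
by move=> u; rewrite thT.
Qed.

Theorem two_stage_bound D f (eps alpha L : R) mu (K : R) :
  (0 < d)%N -> 0 < eps -> 0 < L -> 2 < alpha ->
  holder_class alpha L (thicken D eps) f -> D° mu -> is_argmax_on D f mu ->
  lambda_max (hessian (thicken D eps) f mu) < 0 -> 0 < K ->
  exists K' delta0 : R, [/\ 0 < K', 0 < delta0 &
    forall delta m a (xi : grid d (gridl alpha) * 'I_m -> R)
      (th : mindex d (rord alpha) -> R) muh,
    0 < delta < delta0 -> (0 < m)%N -> D a -> enorm (a - mu) <= delta ->
    (forall j, `|m%:R^-1 * \sum_(s < m) xi (j, s)| <= K * delta `^ alpha) ->
    is_argmin (sse a delta (fun k => f (grid_point a delta k.1) + xi k)) th ->
    is_argmax_on (cube a ((gridl alpha)%:R * delta)) (poly_eval th) muh ->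
    enorm (muh - mu) <= K' * delta `^ (alpha - 1) /\
    `|poly_eval th muh - f mu| <= K' * delta `^ alpha].
Proof.
move=> d0 eps0 L0 a2 [fA fT] Dmu fmax lneg K0.
set A := thicken D eps in fA fT lneg *; set r := rord alpha in fA fT *.
set l := gridl alpha; have a0 : 0 < alpha by lra.
have r2 : (2 <= r)%N by rewrite -rordP.
have rl : (r <= 2 * l)%N by rewrite gridlP.
have l0 : (0 < l)%N by case: (l) rl => //; rewrite muln0 leqn0 => /eqP rz; rewrite rz in r2.
have DA : D `<=` A.
  by move=> x Dx; exists x => //; rewrite /eball/= subrr enorm0 ltW.
have Dmu' : D mu by exact: interior_subset.
have Amu : A° mu by apply: filterS Dmu; exact: DA.
have fA2 : ndifferentiable A 2 f.
  case: r r2 fA {fT rl} => [|[|r]]//= _ [H1 H2]; split => // k.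
  by have [H _] := H2 k.
have fTmu y : A y -> `|f y - taylor A r f mu y| <= L * enorm (y - mu) `^ alpha.
  by move=> Ay; apply: fT => //; exact: DA.
have [c [rho [c0 rho0 Tup]]] :=
  taylor_quadratic_upper_bound d0 a2 L0 Amu Dmu fmax fA2 lneg fTmu.
have Tmu : taylor A r f mu mu = f mu.
  by apply: taylor_at_center fTmu => //; exact: DA.
have [B BE] := least_squares_matrix_exists R d rl.
(* Grid points lie within [N * delta] of [mu]: coordinatewise at most [l * delta] from [a], and [a]
   at most [delta] from [mu]. *)
pose N : R := d%:R * (l%:R + 1); have N0 : 0 <= N by rewrite mulr_ge0// addr_ge0.
pose S := \sum_i \sum_j `|B i j|.
have S0 : 0 <= S by apply: sumr_ge0 => i _; exact: sumr_ge0.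
have LN0 : 0 <= L * N `^ alpha by rewrite mulr_ge0 ?powR_ge0// ltW.
pose Kq := 1 + S * (L * N `^ alpha + K).
have Kq0 : 0 < Kq by rewrite ltr_pwDl// mulr_ge0// addr_ge0// ltW.
have Tup' y : enorm (y - mu) <= rho ->
    taylor A r f mu y <= taylor A r f mu mu - c * enorm (y - mu) ^+ 2.
  by rewrite Tmu; exact: Tup.
have [K' [delta1 [K'0 delta10 H]]] :=
  perturbed_argmax_rate r alpha l0 c0 rho0 Kq0 Tup'.
(* The second bound keeps the grid inside [A], where the Hoelder condition applies. *)
exists K', (Num.min delta1 (eps / (N + 1))); split => //.
  by rewrite lt_min delta10 divr_gt0// ltr_pwDr.
move=> delta m a xi th muh /andP[dl0]; rewrite lt_min ltr_pdivlMr ?ltr_pwDr//.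
move=> /andP[dl1 dle] m0 Da amu xib thmin muhmax.
have t0 : delta != 0 by rewrite gt_eqF.
have ak k : `|mu 0 k - a 0 k| <= delta.
  rewrite distrC; apply: le_trans amu.
  by have := coord_le_enorm (a - mu) k; rewrite !mxE.
have gA j : A (grid_point a delta (j : grid d l)).
  exists a => //; rewrite /eball/= grid_pointE addrC addKr enormZ gtr0_norm//.
  have gn : enorm (grid_node R j) <= N.
    rewrite (le_trans (enorm_le_bound (grid_node_bound R j)))// /N ler_wpM2l//.
    by rewrite lerDl.
  by nra.
have gnear j : enorm (grid_point a delta (j : grid d l) - mu) <= N * delta.
  rewrite /N -mulrA; apply: enorm_le_bound => k; rewrite grid_pointE !mxE.
  have := grid_node_bound R j k; rewrite mxE => gb.
  rewrite addrAC (le_trans (ler_normD _ _))// mulrDl mul1r [leLHS]addrC.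
  apply: lerD; last by rewrite distrC.
  by rewrite normrM (gtr0_norm dl0) mulrC ler_wpM2r// ltW.
have [cT cTE] := poly_eval_affine (@taylor_coef R d A r f mu) (a - mu) delta.
have TE u : taylor A r f mu (a + delta *: u) = poly_eval cT u.
  by rewrite -cTE taylorE addrAC.
have [ch chE] := poly_eval_affine th a delta.
(* By linearity of the fit, [q] is the image under [B] of Taylor remainder plus averaged error. *)
pose q i := ch i - cT i.
rewrite -Tmu; apply: (H delta a muh (poly_eval th) q) => //.
- by rewrite dl0.
- move=> i; rewrite /q (BE _ _ _ _ _ _ m0 t0 thmin chE).
  rewrite (taylor_fit BE t0 TE) -sumrB.
  apply: (le_trans (ler_norm_sum _ _ _)).
  apply: (@le_trans _ _ (\sum_j `|B i j| * ((L * N `^ alpha + K) * delta `^ alpha))).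
    apply: ler_sum => j _; rewrite -mulrBr normrM ler_wpM2l//=.
    rewrite big_split/= sumr_const card_ord -(mulr_natl (f _) m) mulrDr mulKf; last first.
      by rewrite pnatr_eq0 -lt0n.
    rewrite addrAC mulrDl (le_trans (ler_normD _ _))//; apply: lerD => //.
    apply: (le_trans (fTmu _ (gA j))); rewrite -mulrA ler_wpM2l ?(ltW L0)//.
    by rewrite -powRM ?(ltW dl0)// ge0_ler_powR// ?nnegrE ?enorm_ge0 ?mulr_ge0// ltW.
  rewrite -mulr_suml mulrA ler_wpM2r ?powR_ge0// /Kq.
  apply: (@le_trans _ _ (S * (L * N `^ alpha + K))); last by rewrite lerDr.
  rewrite ler_wpM2r ?addr_ge0 ?(ltW K0)// /S (bigD1 i)//= lerDl.
  by apply: sumr_ge0 => *; exact: sumr_ge0.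
move=> u; rewrite TE chE /q /poly_eval -big_split/=; apply: eq_bigr => i _.
by rewrite mulrBl addrC subrK.
Qed.

(* Stochastic order through exceptional events, and the two rates *)
End two_stage_bound.

Section stochastic_order.
Context {disp : measure_display} {Om : measurableType disp} {R : realType}.
Variable P : probability Om R.

(** Both rates come from one bound valid off a small event; measurability of [X n] justifies
    monotonicity of [P]. *)
Lemma bigO_p_exceptional (X : nat -> Om -> R) (a : nat -> R) :
  (\forall n \near \oo, measurable_fun setT (X n)) ->
  (forall eta : R, 0 < eta -> exists2 K : R, 0 < K &
    \forall n \near \oo, exists N : set Om, [/\ measurable N, (P N <= eta%:E)%E &
      forall w, ~ N w -> `|X n w| <= K * a n]) ->
  bigO_p P X a.
Proof.
move=> mX H eta eta0; have [K K0 KP] := H _ eta0; exists K => //.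
apply: filterS2 mX KP => n mXn [N [mN PN XN]]; apply: le_trans PN.
apply: le_measure; rewrite ?inE//.
  by apply: measurable_set_lt; exact: measurableT_comp.
by move=> w /= h; apply: contrapT => /XN; rewrite leNgt h.
Qed.

Lemma measure_bigsetU_le (I : Type) (s : seq I) (E : I -> set Om) (e : R) :
  (forall i, measurable (E i)) -> (forall i, (P (E i) <= e%:E)%E) ->
  (P (\big[setU/set0]_(i <- s) E i) <= ((size s)%:R * e)%:E)%E.
Proof.
move=> mE PE; elim: s => [|i s ihs]; first by rewrite big_nil measure0 mul0r.
rewrite big_cons; apply: (@le_trans _ _ (P (E i) + P (\big[setU/set0]_(j <- s) E j))%E).
  by apply: measureU2 => //; exact: bigsetU_measurable.
by rewrite -[(size _)%:R]natr1 addrC mulrDl mul1r EFinD; exact: leeD.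
Qed.

Lemma near_powRN_lt (p e : R) : 0 < p -> 0 < e ->
  \forall n \near \oo, 0 < n%:R `^ (- p) < e.
Proof.
move=> p0 e0; apply: filterS (nbhs_infty_gtr (e `^ (- p^-1))) => n ne.
have n0 : 0 < n%:R :> R by apply: le_lt_trans ne; exact: powR_ge0.
rewrite powR_gt0//= powRN -[ltRHS]invrK ltf_pV2 ?posrE ?invr_gt0 ?powR_gt0//.
have -> : e^-1 = (e `^ (- p^-1)) `^ p.
  by rewrite -powRrM mulNr mulVf ?gt_eqF// powR_inv1// ltW.
by apply: gt0_ltr_powR => //; rewrite nnegrE ?powR_ge0// ltW.
Qed.

End stochastic_order.

Lemma measurable_mpow (disp : measure_display) (Om : measurableType disp)
    (R : realType) (d : nat) (g : Om -> 'rV[R]_d) (i : 'I_d -> nat) :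
  (forall k, measurable_fun setT (fun w => g w 0 k)) ->
  measurable_fun setT (fun w => mpow (g w) i).
Proof.
move=> mg; apply: measurable_prod => k _.
exact: measurable_funX.
Qed.

Lemma measurable_enorm (disp : measure_display) (Om : measurableType disp)
    (R : realType) (d : nat) (g : Om -> 'rV[R]_d) :
  (forall k, measurable_fun setT (fun w => g w 0 k)) ->
  measurable_fun setT (fun w => enorm (g w)).
Proof.
move=> mg; apply: (@measurableT_comp _ _ _ _ _ _ (@Num.sqrt R)).
  exact: continuous_measurable_fun (@sqrt_continuous R).
by apply: measurable_sum => k; exact: measurable_funX.
Qed.

Theorem corollary1 (R : realType) (d : nat) (hd : (0 < d)%N)
  (* regression function *)
  (D : set 'rV[R]_d) (f : 'rV[R]_d -> R) (eps alpha L : R) (mu : 'rV[R]_d)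
  (hDcompact : compact D)
  (hDconvex : convex_set (D : set (convex_lmodType 'rV[R]_d)))
  (halpha : 1 + Num.sqrt (1 + d%:R / 2) < alpha)
  (heps : 0 < eps) (hL : 0 < L) (halpha2 : 2 < alpha)
  (hf : holder_class alpha L (thicken D eps) f)
  (hmu_int : D° mu) (hmu_max : is_argmax_on D f mu)
  (hmu_uniq : forall x, D° x -> is_argmax_on D f x -> x = mu)
  (hmu_hess : lambda_max (hessian (thicken D eps) f mu) < 0)
  (* errors and sample sizes; n is the total budget *)
  (disp : measure_display) (Om : measurableType disp) (P : probability Om R)
  (sigma upsilon : R) (n1 n3 : nat -> nat)
  (xi1 : forall n, 'I_(n1 n) -> {RV P >-> R})
  (xi2 : forall n, grid d (gridl alpha) * 'I_(n3 n) -> {RV P >-> R})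
  (hindep : forall n, mutually_independent P
     (sum_family (fun i => xi1 n i : Om -> R) (fun k => xi2 n k : Om -> R)))
  (hmean1 : forall n i, 'E_P[xi1 n i]%E = 0%E)
  (hvar1 : forall n i, 'V_P[xi1 n i]%E = (sigma ^+ 2)%:E)
  (hmean2 : forall n k, 'E_P[xi2 n k]%E = 0%E)
  (hvar2 : forall n k, 'V_P[xi2 n k]%E = (sigma ^+ 2)%:E)
  (hn1 : \forall n \near \oo, (0 < n1 n < n)%N)
  (hn : \forall n \near \oo,
     n = (n1 n + n3 n * (2 * gridl alpha + 1) ^ d)%N)
  (hupsilon : 0 < upsilon < 1)
  (hratio : (n1 n)%:R / n%:R @[n --> \oo] --> upsilon)
  (* first stage *)
  (c1 c2 : R) (hc1 : 0 < c1) (hc2 : 0 < c2)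
  (xt : forall n, 'I_(n1 n) -> 'rV[R]_d)
  (hxt_D : \forall n \near \oo, forall i, D (xt n i))
  (hxt_cover : \forall n \near \oo,
     D `<=` \bigcup_(i in [set: 'I_(n1 n)])
               eball (xt n i) (c1 * n%:R `^ (- (d%:R)^-1)))
  (hxt_sep : \forall n \near \oo, forall i j, i != j ->
     c2 * n%:R `^ (- (d%:R)^-1) <= enorm (xt n i - xt n j))
  (est : forall n, (n1 n).-tuple R -> 'rV[R]_d)
  (hest_D : forall n y, D (est n y))
  (hest_meas : forall n k, measurable_fun setT (fun y => est n y 0 k))
  (mut : nat -> Om -> 'rV[R]_d)
  (hmut : forall n w,
     mut n w = est n [tuple f (xt n i) + xi1 n i w | i < n1 n])
  (* second stage *)
  (delta : nat -> R)
  (hdelta : forall n, delta n = n%:R `^ (- (2 * alpha)^-1))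
  (theta : nat -> Om -> mindex d (rord alpha) -> R)
  (htheta : \forall n \near \oo, forall w, is_argmin
     (sse (mut n w) (delta n)
        (fun k => f (grid_point (mut n w) (delta n) k.1) + xi2 n k w))
     (theta n w))
  (muh : nat -> Om -> 'rV[R]_d)
  (hmuh_meas : forall n k, measurable_fun setT (fun w => muh n w 0 k))
  (hmuh : \forall n \near \oo, forall w, is_argmax_on
     (cube (mut n w) ((gridl alpha)%:R * delta n))
     (poly_eval (theta n w)) (muh n w))
  (* rate of the preliminary estimator *)
  (hrate : littleo_p P (fun n w => enorm (mut n w - mu))
             (fun n => n%:R `^ (- (2 * alpha)^-1))) :
  bigO_p P (fun n w => enorm (muh n w - mu))
    (fun n => n%:R `^ (- ((alpha - 1) / (2 * alpha)))) /\
  bigO_p P (fun n w => poly_eval (theta n w) (muh n w) - f mu)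
    (fun n => n%:R `^ (- 2^-1)).
Proof.
set r := rord alpha in theta htheta hmuh *.
set l := gridl alpha in xi2 hindep hmean2 hvar2 hn htheta hmuh *.
have a0 : 0 < alpha by lra.
have ia0 : 0 < (2 * alpha)^-1 by rewrite invr_gt0 mulr_gt0.
have rl : (r <= 2 * l)%N by rewrite gridlP.
pose J := #|{: grid d l}|.
have JE : J = ((2 * l + 1) ^ d)%N by rewrite /J card_ffun !card_ord.
have J0 : (0 < J)%N by rewrite JE expn_gt0 addn1.
have delta_alpha n : delta n `^ alpha = n%:R `^ (- 2^-1).
  by rewrite hdelta -powRrM mulNr invfM mulfVK// gt_eqF.
have delta_alpha1 n : delta n `^ (alpha - 1) = n%:R `^ (- ((alpha - 1) / (2 * alpha))).
  by rewrite hdelta -powRrM mulNr mulrC.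
have delta_small e : 0 < e -> \forall n \near \oo, 0 < delta n < e.
  move=> e0; have := near_powRN_lt ia0 e0.
  by apply: filterS => n; rewrite hdelta.
have Dmu : D mu by exact: interior_subset.
have DA : D `<=` thicken D eps.
  by move=> x Dx; exists x => //; rewrite /eball/= subrr enorm0 ltW.
have mutD n w : D (mut n w) by rewrite hmut.
have mmut n k : measurable_fun setT (fun w => mut n w 0 k).
  rewrite (_ : (fun w => _) = (fun y => est n y 0 k) \o
      (fun w => [tuple f (xt n i) + xi1 n i w | i < n1 n])); last first.
    by apply/funext => w; rewrite hmut.
  apply: measurableT_comp; first exact: hest_meas.
  apply/measurable_fun_tnthP => i.
  rewrite (_ : _ \o _ = fun w => f (xt n i) + xi1 n i w).
    exact: measurable_funD.
  by apply/funext => w; rewrite /= tnth_mktuple.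
have n3_gt0 : \forall n \near \oo, (0 < n3 n)%N.
  apply: filterS2 hn1 hn => n /andP[_ n1n] hnE.
  rewrite lt0n; apply: contraTneq n1n => z.
  by rewrite -leqNgt [X in (X <= _)%N]hnE z mul0n addn0.
(* The second stage takes a share of the budget tending to [1 - upsilon], hence eventually at least
   half of that; it equals [n3 n * J]. *)
pose kappa : R := 2 * J%:R / (1 - upsilon).
have u1 : 0 < 1 - upsilon by case/andP: hupsilon => _ ?; rewrite subr_gt0.
have kappa0 : 0 < kappa by rewrite divr_gt0// mulr_gt0// ltr0n.
have n_le_n3 : \forall n \near \oo, n%:R <= kappa * (n3 n)%:R.
  have uu : upsilon < (1 + upsilon) / 2 by lra.
  have hr : \forall n \near \oo, (n1 n)%:R / n%:R < (1 + upsilon) / 2.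
    exact: cvgr_lt hratio _ uu.
  apply: filterS3 hn1 hn hr => n /andP[n10 n1n] hnE.
  have n0 : 0 < n%:R :> R by rewrite ltr0n (leq_ltn_trans _ n1n).
  rewrite ltr_pdivrMr// => h.
  have hnR : n%:R = (n1 n)%:R + (n3 n)%:R * J%:R :> R by rewrite {1}hnE JE natrD natrM.
  by rewrite /kappa mulrAC ler_pdivlMr//; lra.
(* Measurability of [theta] is not assumed; it is replaced by the rescaled coefficients, which are a
   fixed linear function of the observations. *)
have mM : \forall n \near \oo,
    measurable_fun setT (fun w => poly_eval (theta n w) (muh n w) - f mu).
  have [B BE] := least_squares_matrix_exists R d rl.
  pose N : R := d%:R * l%:R; have N0 : 0 <= N by rewrite mulr_ge0.
  have e0 : 0 < eps / (N + 1) by rewrite divr_gt0// ltr_pwDr.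
  apply: filterS3 n3_gt0 htheta (delta_small _ e0) => n n30 thn /andP[dl0 dle].
  have dn0 : delta n != 0 by rewrite gt_eqF.
  pose y w (k : grid d l * 'I_(n3 n)) :=
    f (grid_point (mut n w) (delta n) k.1) + xi2 n k w.
  pose c w i := \sum_j B i j * ((n3 n)%:R^-1 * \sum_(s < n3 n) y w (j, s)).
  have cE w u : poly_eval (theta n w) (mut n w + delta n *: u) = poly_eval (c w) u.
    have [c' c'E] := poly_eval_affine (theta n w) (mut n w) (delta n).
    rewrite c'E; apply: eq_bigr => i _; congr (_ * _).
    exact: (BE _ _ _ _ _ _ n30 dn0 (thn w) c'E).
  pose v w := (delta n)^-1 *: (muh n w - mut n w).
  rewrite (_ : (fun w => _) = fun w => poly_eval (c w) (v w) - f mu); last first.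
    by apply/funext => w; rewrite -cE /v scalerA mulfV// scale1r (addrC (mut n w)) subrK.
  apply: measurable_funB => //; apply: measurable_sum => i.
  apply: measurable_funM; last first.
    apply: measurable_mpow => k; rewrite /v.
    rewrite (_ : (fun w => _) = fun w => (delta n)^-1 * (muh n w 0 k - mut n w 0 k)).
      by apply: measurable_funM => //; exact: measurable_funB.
    by apply/funext => w; rewrite !mxE.
  apply: measurable_sum => j; apply: measurable_funM => //.
  apply: measurable_funM => //; apply: measurable_sum => s.
  apply: measurable_funD; last exact: measurable_funPT.
  apply: (@measurable_comp_continuous_within _ _ _ _ (thicken D eps)).
  - move=> x e Ax ee0; apply: (holder_continuous halpha2 hL Ax) ee0 => z Az.
    exact: hf.2.
  - move=> k; rewrite (_ : (fun w => _) =
        fun w => mut n w 0 k + ((j k : nat)%:R - l%:R) * delta n).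
      exact: measurable_funD.
    by apply/funext => w; rewrite mxE.
  move=> w; exists (mut n w) => //; rewrite /eball/= grid_pointE addrC addKr enormZ.
  rewrite gtr0_norm//.
  have := enorm_le_bound (grid_node_bound R j); rewrite -/N => gN.
  rewrite ltr_pdivlMr ?ltr_pwDr// in dle; nra.
have main (eta : R) : 0 < eta -> exists2 K : R, 0 < K &
    \forall n \near \oo, exists N : set Om, [/\ measurable N, (P N <= eta%:E)%E &
      forall w, ~ N w ->
        enorm (muh n w - mu) <= K * delta n `^ (alpha - 1) /\
        `|poly_eval (theta n w) (muh n w) - f mu| <= K * delta n `^ alpha].
  move=> eta0.
  (* Chebyshev's inequality will give [sigma ^+ 2 * kappa / K0 ^+ 2] per grid point; since
     [K0 <= K0 ^+ 2], this choice makes it at most [eta / (2 * J)]. *)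
  pose K0 : R := 1 + 2 * J%:R * sigma ^+ 2 * kappa / eta.
  have V0 : 0 <= 2 * J%:R * sigma ^+ 2 * kappa / eta.
    by rewrite divr_ge0 ?(ltW eta0)// mulr_ge0 ?(ltW kappa0)// mulr_ge0 ?sqr_ge0.
  have K01 : 1 <= K0 by rewrite lerDl.
  have K00 : 0 < K0 by exact: lt_le_trans K01.
  have [K [dl1 [Kp dl10 KP]]] :=
    two_stage_bound hd heps hL halpha2 hf hmu_int hmu_max hmu_hess K00.
  exists K => //.
  have Pmut : \forall n \near \oo,
      (P [set w | (delta n < enorm (mut n w - mu))%R] <= (eta / 2)%:E)%E.
    have e2 : (0 < (eta / 2)%:E)%E by rewrite lte_fin divr_gt0.
    have : \forall n \near \oo, (P [set w | (1 * n%:R `^ (- (2 * alpha)^-1) <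
        `|enorm (mut n w - mu)|)%R] < (eta / 2)%:E)%E.
      exact: (hrate 1 ltr01 _
        (open_nbhs_nbhs (conj (@open_ereal_lt_ereal R (eta / 2)%:E) e2))).
    apply: filterS => n /ltW; apply: le_trans.
    rewrite le_eqVlt; apply/orP; left; apply/eqP; congr (P _).
    apply/seteqP; split => w /=; rewrite mul1r -hdelta ger0_norm ?enorm_ge0//.
  have good : \forall n \near \oo, [/\ (0 < n)%N, (0 < n3 n)%N,
      n%:R <= kappa * (n3 n)%:R & 0 < delta n < dl1].
    near=> n; split; first by near: n; exact: nbhs_infty_gt.
    - by near: n.
    - by near: n.
    - by near: n; exact: delta_small.
  apply: filterS3 Pmut good (filterI htheta hmuh) => n Pn [n0 n30 nk dl] [thn muhn].
  have n0R : 0 < n%:R :> R by rewrite ltr0n.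
  have n30R : 0 < (n3 n)%:R :> R by rewrite ltr0n.
  pose t : R := (n3 n)%:R * (K0 * delta n `^ alpha).
  have da0 : 0 < delta n `^ alpha by case/andP: dl => ? _; exact: powR_gt0.
  have t0 : 0 < t by rewrite !mulr_gt0.
  pose E (j : grid d l) := [set w | t <= `|\sum_(s < n3 n) xi2 n (j, s) w|].
  have mE j : measurable (E j).
    rewrite (_ : E j = ~` [set w | - t < - `|\sum_(s < n3 n) xi2 n (j, s) w|]).
      apply/measurableC/measurable_set_lt; apply: measurableT_comp => //.
      apply: measurableT_comp => //; apply: measurable_sum => s; exact: measurable_funPT.
    by apply/seteqP; split => w; rewrite /E/= ltrN2 leNgt => /negP.
  have PE j : (P (E j) <= (eta / (2 * J%:R))%:E)%E.
    have ind s s' : s != s' ->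
        independent_pair P (xi2 n (j, s) : Om -> R) (xi2 n (j, s') : Om -> R).
      move=> ss'; apply: (@mutually_independent_pair _ _ _ _ _ _
        (inr (j, s)) (inr (j, s')) (hindep n)).
      by apply: contra_neq ss' => -[].
    have := @chebyshev_sum_independent _ _ _ P _ (fun s => xi2 n (j, s)) _ t ind
      (fun s => hmean2 n (j, s)) (fun s => hvar2 n (j, s)) t0.
    move=> /le_trans; apply; rewrite lee_fin card_ord /t.
    have -> : delta n `^ alpha = (Num.sqrt n%:R)^-1.
      by rewrite delta_alpha powRN -powR12_sqrt// div1r.
    have sq : Num.sqrt n%:R ^+ 2 = n%:R :> R by rewrite sqr_sqrtr.
    have s0 : 0 < Num.sqrt n%:R :> R by rewrite sqrtr_gt0.
    rewrite !exprMn exprVn sq.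
    rewrite (_ : _ / _ = sigma ^+ 2 * (n%:R / (n3 n)%:R) / K0 ^+ 2); last first.
      by field; rewrite !gt_eqF.
    rewrite ler_pdivrMr ?exprn_gt0//.
    apply: (@le_trans _ _ (sigma ^+ 2 * kappa)).
      by rewrite ler_wpM2l ?sqr_ge0// ler_pdivrMr.
    apply: (@le_trans _ _ (eta / (2 * J%:R) * K0)); last first.
      by rewrite ler_wpM2l ?divr_ge0 ?(ltW eta0)// expr2 ler_peMl// ltW.
    rewrite /K0 mulrDr mulr1.
    have -> : eta / (2 * J%:R) * (2 * J%:R * sigma ^+ 2 * kappa / eta) = sigma ^+ 2 * kappa.
      by field; rewrite !gt_eqF// ltr0n.
    by rewrite lerDr divr_ge0// ltW.
  pose A := [set w | delta n < enorm (mut n w - mu)].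
  have mA : measurable A.
    apply: measurable_set_lt; apply: measurable_enorm => k.
    rewrite (_ : (fun w => _) = fun w => mut n w 0 k - mu 0 k).
      exact: measurable_funB.
    by apply/funext => w; rewrite !mxE.
  pose U := \big[setU/set0]_(j <- enum {: grid d l}) E j.
  have mU : measurable U by exact: bigsetU_measurable.
  (* Half of [eta] goes to the preliminary estimator, the other half is shared by the [J] grid
     points. *)
  exists (A `|` U); split; first exact: measurableU.
    apply: (@le_trans _ _ (P A + P U)%E); first exact: measureU2.
    rewrite [eta in leRHS](splitr eta) EFinD; apply: leeD => //.
    apply: (le_trans (measure_bigsetU_le _ mE PE)).
    rewrite -cardE -/J lee_fin le_eqVlt; apply/orP; left; apply/eqP.
    by field; rewrite gt_eqF// ltr0n.
  move=> w /not_orP[wA wU].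
  apply: (KP (delta n) (n3 n) (mut n w) (fun k => xi2 n k w)) => //.
  - by rewrite leNgt; apply/negP.
  - move=> j; have wE : ~ E j w.
      by apply: contra_not wU => wE; rewrite /U -bigcup_seq; exists j => //=; rewrite mem_enum.
    rewrite normrM normfV (gtr0_norm n30R) ler_pdivrMl// ltW// ltNge.
    exact/negP.
split; apply: bigO_p_exceptional.
- apply: nearW => n; apply: measurable_enorm => k.
  rewrite (_ : (fun w => _) = fun w => muh n w 0 k - mu 0 k).
    exact: measurable_funB.
  by apply/funext => w; rewrite !mxE.
- move=> eta /main[K K0 KP]; exists K => //; apply: filterS KP => n [N [mN PN NP]].
  exists N; split => // w /NP[h _].
  by rewrite (ger0_norm (enorm_ge0 _)) -delta_alpha1.
- exact: mM.
move=> eta /main[K K0 KP]; exists K => //; apply: filterS KP => n [N [mN PN NP]].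
by exists N; split => // w /NP[]; rewrite delta_alpha.
Unshelve. all: by end_near. Qed.
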